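(* Let $\mathsf F$ be a convex subcategory of quantum channels with superchannels (as described in the context), let $A=A_0A_1$ and $A'=A'_0A'_1$ be admissible in $\mathsf F$, let $\Phi_1\in\mathcal C(A_0,A_1)$, $\Phi_2\in\mathcal C(A'_0,A'_1)$ and $\epsilon\ge0$. The following are equivalent. (i) $\delta_{\mathsf F}(\Phi_1\|\Phi_2)\le\epsilon$. (ii) For every state $\rho\in\mathfrak S(A'_0A'_1)$ there is some $\Theta\in\bar{\mathsf F}(A,A')$ (the closure of $\mathsf F(A,A')$) such that $\langle\rho,\Phi_2\rangle\le\langle\rho,\Theta(\Phi_1)\rangle+\frac{\epsilon}{2}\|\rho\|^\diamond_{A'_1|A'_0}$. (iii) For every $R=R_0R_1$ admissible in $\mathsf F$ and every $\rho\in\mathfrak S(R_0R_1)$, $$\sup_{\Theta\in\mathsf F(A',R)}\langle\rho,\Theta(\Phi_2)\rangle\le\sup_{\Theta\in\mathsf F(A,R)}\langle\rho,\Theta(\Phi_1)\rangle+\frac{\epsilon}{2}\|\rho\|^\diamond_{R_1|R_0}.$$ Moreover, (i) is also equivalent to condition (iii) required only for $R_0=A'_0$, $R_1=A'_1$.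
   Context: All Hilbert spaces are finite-dimensional; $\mathcal B(A)$, $\mathcal B_h(A)$, $\mathcal B_+(A)$, $\mathfrak S(A)$ denote operators, self-adjoint, positive operators and states on $\mathcal H_A$. $\mathcal L(A_0,A_1)$ is the real space of hermitian linear maps $\mathcal B(A_0)\to\mathcal B(A_1)$ and $\mathcal C(A_0,A_1)$ the set of channels (completely positive trace preserving maps). For $\phi\in\mathcal L(A_0,A_1)$ the Choi matrix is $C_\phi=(\phi\otimes\mathrm{id}_{A_0})(|I_{A_0}\rangle\rangle\langle\langle I_{A_0}|)$ with $|I\rangle\rangle=\sum_i|i\rangle\otimes|i\rangle$. For $X\in\mathcal B_h(A_0A_1)$ and $\phi\in\mathcal L(A_0,A_1)$ the pairing is $\langle X,\phi\rangle={\rm Tr}[XC_{\phi^*}]$, where $\phi^*\in\mathcal L(A_1,A_0)$ is the Hilbert–Schmidt adjoint. For $\rho\in\mathcal B_+(A_0A_1)$, $\|\rho\|^\diamond_{A_1|A_0}=\max_{\alpha\in\mathcal C(A_0,A_1)}\langle\rho,\alpha\rangle=\min\{\lambda>0:\rho\le\lambda\,\sigma\otimes I_{A_1},\ \sigma\in\mathfrak S(A_0)\}$ $(=2^{-H_{\min}(A_1|A_0)_\rho})$. The diamond norm is $\|\Phi\|_\diamond=\max_{\rho\in\mathfrak S(A_0A_0)}\|(\Phi\otimes\mathrm{id})(\rho)\|_1$. A superchannel $\Lambda\in\mathcal C_2(A,A')$ (with $A=A_0A_1$, $A'=A'_0A'_1$) is given by an ancilla $U$, a preprocessing $\Lambda_{\rm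 pre}\in\mathcal C(A'_0,UA_0)$ and a postprocessing $\Lambda_{\rm post}\in\mathcal C(UA_1,A'_1)$; it acts on $\Phi\in\mathcal L(A_0,A_1)$ by $\Lambda(\Phi)=\Lambda_{\rm post}\circ(\mathrm{id}_U\otimes\Phi)\circ\Lambda_{\rm pre}\in\mathcal L(A'_0,A'_1)$, and it is itself regarded as a channel in $\mathcal C(A'_0A_1,A'_1A_0)$. A convex subcategory $\mathsf F$ of quantum channels with superchannels consists of a class of pairs $A=A_0A_1$ called admissible and, for admissible $A,A'$, convex sets $\mathsf F(A,A')\subseteq\mathcal C_2(A,A')$ containing the identity superchannels and closed under composition of superchannels. $\delta_{\mathsf F}(\Phi_1\|\Phi_2)=\inf_{\Lambda\in\mathsf F(A,A')}\|\Lambda(\Phi_1)-\Phi_2\|_\diamond$. (The quantity $\sup_{\Theta\in\mathsf F(A,R)}\langle\rho,\Theta(\Phi_1)\rangle$ is what the paper writes as $\|\rho*C_{\Phi_1}\|^{\mathsf F}_{R|A}$, a modified conditional min-entropy $-\log$ of which is considered.) *)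

(* Defs.v *)
Set Warnings "-notation-overridden,-ambiguous-paths".
From HB Require Import structures.
From mathcomp Require Import all_boot all_order all_algebra.
From mathcomp Require Import sesquilinear spectral.
From mathcomp Require Import complex mxtens.
From mathcomp Require Import boolp classical_sets reals constructive_ereal ereal.

Set Implicit Arguments.
Unset Strict Implicit.
Unset Printing Implicit Defensive.

Import Order.TTheory GRing.Theory Num.Theory.
Local Open Scope ring_scope.
Local Open Scope classical_set_scope.

Section QDefs.
Variable R : realType.
Local Notation C := R[i].

(* Hermitian linear maps B(A_0) -> B(A_1), with dim A_0 = m, dim A_1 = n
   (as C-linear maps; all maps used below are linear). *)
Definition lmap (m n : nat) := 'Hom('M[C]_m, 'M[C]_n).

Definition adjmx m n (X : 'M[C]_(m, n)) : 'M[C]_(n, m) := (map_mx Num.conj X)^T.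

Definition psd n (X : 'M[C]_n) : Prop :=
  X \is hermsymmx /\ forall v : 'rV[C]_n, 0 <= (v *m X *m adjmx v) 0 0.
Definition state n (X : 'M[C]_n) : Prop := psd X /\ \tr X = 1.

Definition tens_id m n k (f : 'M[C]_m -> 'M[C]_n) (X : 'M[C]_(m * k)) : 'M[C]_(n * k) :=
  \sum_(k1 < k) \sum_(l1 < k)
    f (\matrix_(i, j) X (mxtens_index (i, k1)) (mxtens_index (j, l1)))
      *t (delta_mx k1 l1 : 'M[C]_k).
Arguments tens_id {m n} k f X.
Definition id_tens m n u (f : 'M[C]_m -> 'M[C]_n) (X : 'M[C]_(u * m)) : 'M[C]_(u * n) :=
  \sum_(i1 < u) \sum_(j1 < u)
    (delta_mx i1 j1 : 'M[C]_u)
      *t f (\matrix_(k, l) X (mxtens_index (i1, k)) (mxtens_index (j1, l))).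
Arguments id_tens {m n} u f X.

Definition maxent n : 'M[C]_(n * n, 1) :=
  \sum_(i < n) (delta_mx i 0 : 'M[C]_(n, 1)) *t (delta_mx i 0 : 'M[C]_(n, 1)).

Definition choi m n (f : 'M[C]_m -> 'M[C]_n) : 'M[C]_(n * m) :=
  tens_id m f (maxent m *m adjmx (maxent m)).

(* Hilbert-Schmidt adjoint f^* : Tr[Y^dag f(X)] = Tr[(f^* Y)^dag X]. *)
Definition hs_adj m n (f : 'M[C]_m -> 'M[C]_n) (Y : 'M[C]_n) : 'M[C]_m :=
  \matrix_(i, j) \tr (adjmx (f (delta_mx i j)) *m Y).

Definition pairing m n (X : 'M[C]_(m * n)) (f : lmap m n) : C :=
  \tr (X *m choi (hs_adj f)).

Definition CPmap m n (f : lmap m n) : Prop :=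
  forall k (X : 'M[C]_(m * k)), psd X -> psd (tens_id k f X).
Definition TPmap m n (f : lmap m n) : Prop := forall X, \tr (f X) = \tr X.
Definition channel m n (f : lmap m n) : Prop := CPmap f /\ TPmap f.

Definition cnorm m n (rho : 'M[C]_(m * n)) : R :=
  sup [set complex.Re (pairing rho a) | a in [set a : lmap m n | channel a]].

(* Trace norm ||X||_1 = Tr sqrt(X^dag X) (via the spectral decomposition of X^dag X). *)
Definition trnorm n (X : 'M[C]_n) : R :=
  \sum_(i < n) Num.sqrt (complex.Re (spectral_diag (adjmx X *m X) 0 i)).

Definition dnorm m n (f : lmap m n) : R :=
  sup [set trnorm (tens_id m f rho) | rho in [set rho : 'M[C]_(m * m) | state rho]].

Definition supch a0 a1 b0 b1 := 'Hom(lmap a0 a1, lmap b0 b1).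

Definition is_superchannel a0 a1 b0 b1 (L : supch a0 a1 b0 b1) : Prop :=
  exists (u : nat) (pre : lmap b0 (u * a0)) (post : lmap (u * a1) b1),
    [/\ channel pre, channel post &
        forall (Phi : lmap a0 a1) (X : 'M[C]_b0), L Phi X = post (id_tens u Phi (pre X))].

(* Closure of a set of superchannels (pointwise = norm topology, finite dimension). *)
Definition sc_closure a0 a1 b0 b1 (S : set (supch a0 a1 b0 b1)) : set (supch a0 a1 b0 b1) :=
  fun Th => exists L : nat -> supch a0 a1 b0 b1, (forall k, S (L k)) /\
    forall (Phi : lmap a0 a1) (X : 'M[C]_b0) (i j : 'I_b1) (e : R), 0 < e ->
      exists N : nat, forall k, (N <= k)%N ->
        `|(L k Phi X - Th Phi X) i j| < real_complex R e.

(* Convex subcategory of quantum channels with superchannels: the admissible pairs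
   are indexed by I, with dim A_0 = d0 A and dim A_1 = d1 A. *)
Definition convex_subcategory (I : Type) (d0 d1 : I -> nat)
  (F : forall A B : I, set (supch (d0 A) (d1 A) (d0 B) (d1 B))) : Prop :=
  [/\ (forall A B L, F A B L -> is_superchannel L),
      (forall A B L1 L2 (t : R), F A B L1 -> F A B L2 -> 0 <= t <= 1 ->
          F A B (real_complex R t *: L1 + real_complex R (1 - t) *: L2)),
      (forall A, F A A \1%VF) &
      (forall A B D L L', F A B L -> F B D L' -> F A D (L' \o L)%VF)].

Definition deltaF (I : Type) (d0 d1 : I -> nat)
  (F : forall A B : I, set (supch (d0 A) (d1 A) (d0 B) (d1 B))) (A A' : I)
  (Phi1 : lmap (d0 A) (d1 A)) (Phi2 : lmap (d0 A') (d1 A')) : \bar R :=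
  ereal_inf [set (dnorm (L Phi1 - Phi2))%:E | L in F A A'].

End QDefs.

(* Main.v *)
(* Pairing a test operator rho >= 0 with a difference f of two channels and taking the
   supremum over rho of norm ||rho||^<> <= 1 gives half the diamond norm of f.

   One inequality is elementary: half the trace norm of (f (x) id)(s) is attained as
   Tr[E (f (x) id)(s)] for some 0 <= E <= 1, which is the pairing of f with an operator
   built from E and s whose norm is at most 1.  The other one needs strong duality:
   rho <= t (x) 1 for some t of trace close to ||rho||^<>, which realises rho as such
   an operator up to the factor Tr t.

   (iii) for R = A', and also (ii), says that every rho has an almost optimal response
   in F(A, A').  Since F(A, A') is convex and the set of tests is convex and totally
   bounded, a minimax theorem provides one response that works for all rho, that is
   (i).  Conversely, a superchannel pulls a test operator back to a test operator without
   increasing its norm, so (i) implies (iii); (ii) follows by compactness of the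
   set of superchannels. *)
Require Import Defs.
Set Warnings "-notation-overridden,-ambiguous-paths".
From HB Require Import structures.
From mathcomp Require Import all_boot all_order all_algebra.
From mathcomp Require Import sesquilinear spectral.
From mathcomp Require Import complex mxtens.
From mathcomp Require Import boolp classical_sets reals constructive_ereal ereal.
From mathcomp Require Import ring lra.
Import Order.TTheory GRing.Theory Num.Theory.
Local Open Scope ring_scope.
Local Open Scope classical_set_scope.

Set Implicit Arguments.
Unset Strict Implicit.
Unset Printing Implicit Defensive.

(** The factor one half comes from trace preservation: for a difference [f] of two channels,
    [(f (x) id)(s)] is hermitian with trace zero, so its trace norm is twice the trace of its
    positive part. One approximate minimax statement for bounded sets of matrices serves twice: for
    strong duality, and for finding a single response to all tests. A slack [e] is carried
    everywhere, because [F A A'] need not be closed and the infimum in (i) and the suprema in (iii)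
    need not be attained. The obstacle to compactness is the ancilla of a superchannel, whose
    dimension is not bounded. A bound that ignores it comes from positivity: superchannels preserve
    complete positivity, the entries of a positive matrix are bounded by its trace, and positive
    matrices and completely positive maps span everything. *)

Section PositiveMatrices.
Variable R : realType.
Local Notation C := R[i].

(** * Positive semidefinite matrices and the spectral theorem *)

Lemma entryD m n (X Y : 'M[C]_(m, n)) i j : (X + Y) i j = X i j + Y i j.
Proof. by rewrite mxE. Qed.

Lemma entryB m n (X Y : 'M[C]_(m, n)) i j : (X - Y) i j = X i j - Y i j.
Proof. by rewrite !mxE. Qed.

Lemma entryZ m n a (X : 'M[C]_(m, n)) i j : (a *: X) i j = a * X i j.
Proof. by rewrite mxE. Qed.

Lemma adjmxE m n (X : 'M[C]_(m, n)) i j : adjmx X i j = (X j i)^*.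
Proof. by rewrite !mxE. Qed.

Lemma adjmxK m n (X : 'M[C]_(m, n)) : adjmx (adjmx X) = X.
Proof. by apply/matrixP => i j; rewrite !mxE conjCK. Qed.

Lemma adjmxM m n p (X : 'M[C]_(m, n)) (Y : 'M[C]_(n, p)) :
  adjmx (X *m Y) = adjmx Y *m adjmx X.
Proof. by rewrite /adjmx map_mxM trmx_mul. Qed.

Lemma adjmxD m n (X Y : 'M[C]_(m, n)) : adjmx (X + Y) = adjmx X + adjmx Y.
Proof. by rewrite /adjmx map_mxD linearD. Qed.

Lemma adjmxN m n (X : 'M[C]_(m, n)) : adjmx (- X) = - adjmx X.
Proof. by apply/matrixP => i j; rewrite !mxE rmorphN. Qed.

Lemma adjmxZ m n a (X : 'M[C]_(m, n)) : adjmx (a *: X) = a^* *: adjmx X.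
Proof. by rewrite /adjmx map_mxZ linearZ. Qed.

Lemma adjmx1 n : adjmx (1%:M : 'M[C]_n) = 1%:M.
Proof. by rewrite /adjmx map_mx1 trmx1. Qed.

Lemma hermsymmxE n (X : 'M[C]_n) : (X \is hermsymmx) = (adjmx X == X).
Proof. by rewrite is_hermitianmxE expr0 scale1r /adjmx map_trmx eq_sym. Qed.

Definition qform n (X : 'M[C]_n) (v : 'rV[C]_n) : C := (v *m X *m adjmx v) 0 0.

Lemma sesqE n (X : 'M[C]_n) (u v : 'rV[C]_n) :
  (u *m X *m adjmx v) 0 0 = \sum_i \sum_j u 0 i * X i j * (v 0 j)^*.
Proof.
by rewrite mxE exchange_big; apply: eq_bigr => j _; rewrite adjmxE mxE mulr_suml.
Qed.

Lemma sesq_delta n (X : 'M[C]_n) i j :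
  ((delta_mx 0 i : 'rV[C]_n) *m X *m adjmx (delta_mx 0 j : 'rV[C]_n)) 0 0 = X i j.
Proof.
rewrite sesqE (bigD1 i) //= (bigD1 j) //= !mxE !eqxx mul1r conjC1 mulr1.
rewrite big1 => [|k nkj]; last by rewrite !mxE (negPf nkj) conjC0 mulr0.
rewrite addr0 big1 ?addr0 // => k nki; apply: big1 => l _.
by rewrite !mxE (negPf nki) !mul0r.
Qed.

Lemma qform_delta2 n (X : 'M[C]_n) i j c :
  qform X (delta_mx 0 i + c *: delta_mx 0 j)
  = X i i + c^* * X i j + c * X j i + c * c^* * X j j.
Proof.
rewrite /qform adjmxD adjmxZ !(mulmxDl, mulmxDr) -!(scalemxAl, scalemxAr).
move: (sesq_delta X i i) (sesq_delta X i j) (sesq_delta X j i) (sesq_delta X j j).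
set a := _ *m _; set b := _ *m _; set d := _ *m _; set e := _ *m _.
move: a b d e => a b d e.
rewrite !(entryD, entryZ) => -> -> -> ->.
by rewrite !addrA mulrA.
Qed.

(* A complex form with real values is hermitian by polarization. *)
Lemma psd_qform n (X : 'M[C]_n) : (forall v, 0 <= qform X v) -> psd X.
Proof.
move=> hX; split=> //; rewrite hermsymmxE -subr_eq0; apply/eqP.
set Y := _ - _.
have hY v : qform Y v = 0.
  rewrite /qform /Y mulmxBr mulmxBl entryB.
  apply/eqP; rewrite subr_eq0; apply/eqP.
  have <- : adjmx (v *m X *m adjmx v) = v *m adjmx X *m adjmx v.
    by rewrite !adjmxM adjmxK mulmxA.
  by rewrite adjmxE; apply/CrealP/ger0_real/hX.
have hd i : Y i i = 0 by rewrite -sesq_delta -/(qform _ _) hY.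
apply/matrixP => i j; rewrite [RHS]mxE.
have := hY (delta_mx 0 i + 1 *: delta_mx 0 j).
have := hY (delta_mx 0 i + 'i *: delta_mx 0 j).
rewrite !qform_delta2 !hd conjCi conjC1 !mulr0 !addr0 !add0r !mul1r.
rewrite mulNr => /eqP; rewrite addrC subr_eq0 => /eqP /(mulfI (neq0Ci _)) ->.
by move=> /eqP; rewrite -mulr2n mulrn_eq0 /= => /eqP.
Qed.

Lemma psd_qform_ge0 n (X : 'M[C]_n) v : psd X -> 0 <= qform X v.
Proof. by case=> _; apply. Qed.

Lemma psd_adjmx n (X : 'M[C]_n) : psd X -> adjmx X = X.
Proof. by case; rewrite hermsymmxE => /eqP. Qed.

Lemma psd_diag_ge0 n (X : 'M[C]_n) i : psd X -> 0 <= X i i.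
Proof. by move=> hX; rewrite -sesq_delta; apply: psd_qform_ge0. Qed.

Lemma psd_tr_ge0 n (X : 'M[C]_n) : psd X -> 0 <= \tr X.
Proof. by move=> hX; apply: sumr_ge0 => i _; apply: psd_diag_ge0. Qed.

Lemma psd_diag_le_tr n (X : 'M[C]_n) i : psd X -> X i i <= \tr X.
Proof.
move=> hX; rewrite /mxtrace (bigD1 i) //= lerDl.
by apply: sumr_ge0 => j _; apply: psd_diag_ge0.
Qed.

Lemma psd_norm_le_tr n (X : 'M[C]_n) i j : psd X -> `|X i j| <= \tr X.
Proof.
move=> hX; have [/eqP|nX] := boolP (X i j == 0).
  by move=> ->; rewrite normr0 psd_tr_ge0.
(* With this phase both off-diagonal terms of the form at [e_i + c e_j] equal [- |X i j|], so
   positivity gives [2 |X i j| <= X i i + X j j]. *)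
pose c := - (X i j / `|X i j|).
have nn : `|X i j| != 0 by rewrite normr_eq0.
have cn : (`|X i j|)^* = `|X i j| by apply/CrealP/normr_real.
have hc : c * c^* = 1.
  rewrite /c rmorphN mulrNN rmorphM fmorphV /= cn.
  by rewrite mulrACA -normCK expr2 -invfM divff // mulf_neq0.
have hh : c^* * X i j = - `|X i j|.
  rewrite /c rmorphN mulNr rmorphM fmorphV /= cn mulrAC [_^* * _]mulrC -normCK.
  by rewrite expr2 mulfK.
have hji : X j i = (X i j)^* by rewrite -{1}(psd_adjmx hX) adjmxE.
have hh' : c * X j i = - `|X i j|.
  by rewrite hji -[c in LHS]conjCK -rmorphM hh rmorphN /= cn.
have := psd_qform_ge0 (delta_mx 0 i + c *: delta_mx 0 j) hX.
rewrite qform_delta2 hh hh' hc mul1r => h.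
have {}h : `|X i j| *+ 2 <= X i i + X j j.
  rewrite -subr_ge0 mulr2n opprD !addrA.
  by move: h; rewrite addrAC [_ - _ + X j j]addrAC.
rewrite -(@ler_pMn2r _ 2) //; apply: (le_trans h); rewrite mulr2n.
by apply: lerD; apply: psd_diag_le_tr.
Qed.

Lemma psdD n (X Y : 'M[C]_n) : psd X -> psd Y -> psd (X + Y).
Proof.
move=> hX hY; apply: psd_qform => v.
by rewrite /qform mulmxDr mulmxDl entryD addr_ge0 //; apply: psd_qform_ge0.
Qed.

Lemma psdZ n (X : 'M[C]_n) a : 0 <= a -> psd X -> psd (a *: X).
Proof.
move=> ha hX; apply: psd_qform => v.
by rewrite /qform -scalemxAr -scalemxAl entryZ mulr_ge0 //; apply: psd_qform_ge0.
Qed.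

Lemma psd0 n : psd (0 : 'M[C]_n).
Proof. by apply: psd_qform => v; rewrite /qform mulmx0 mul0mx mxE. Qed.

Lemma psd_sum n (T : Type) (s : seq T) (P : pred T) (f : T -> 'M[C]_n) :
  (forall i, P i -> psd (f i)) -> psd (\sum_(i <- s | P i) f i).
Proof. by move=> hf; apply: (big_ind (@psd R n)) hf; [apply: psd0 | apply: psdD]. Qed.

Lemma psd_conjugate m n (A : 'M[C]_(m, n)) X : psd X -> psd (A *m X *m adjmx A).
Proof.
move=> hX; apply: psd_qform => v.
have -> : qform (A *m X *m adjmx A) v = qform X (v *m A).
  by rewrite /qform adjmxM !mulmxA.
exact: psd_qform_ge0.
Qed.

Lemma psd1 n : psd (1%:M : 'M[C]_n).
Proof.
apply: psd_qform => v; rewrite /qform mulmx1 mxE; apply: sumr_ge0 => i _.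
by rewrite adjmxE mul_conjC_ge0.
Qed.

Lemma psd_gram m n (A : 'M[C]_(m, n)) : psd (A *m adjmx A).
Proof. by rewrite -[A in A *m _]mulmx1; apply/psd_conjugate/psd1. Qed.

(** The reindexing [s] is arbitrary, because the submatrix is a conjugate of [X] by a 0-1 matrix.
    Diagonal blocks, swaps and regroupings of tensor factors are all of this form. *)
Lemma psd_mxsub m n (s : 'I_m -> 'I_n) (X : 'M[C]_n) : psd X -> psd (mxsub s s X).
Proof.
move=> hX; pose A := \matrix_(i < m, j < n) ((s i == j)%:R : C).
suff -> : mxsub s s X = A *m X *m adjmx A by apply: psd_conjugate.
apply/matrixP => i j; rewrite !mxE (bigD1 (s j)) //= adjmxE !mxE eqxx conjC1 mulr1.
rewrite (bigD1 (s i)) //= !mxE eqxx mul1r big1 => [|k hk]; last first.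
  by rewrite !mxE eq_sym (negPf hk) mul0r.
rewrite addr0 big1 ?addr0 // => k hk.
by rewrite adjmxE [A j k]mxE eq_sym (negPf hk) conjC0 mulr0.
Qed.

Lemma psd_trmx n (X : 'M[C]_n) : psd X -> psd X^T.
Proof.
move=> hX; apply: psd_qform => v.
suff -> : qform X^T v = qform X (map_mx Num.conj v) by apply: psd_qform_ge0.
rewrite /qform !sesqE exchange_big; apply: eq_bigr => i _; apply: eq_bigr => j _.
by rewrite !mxE conjCK; ring.
Qed.

Lemma hermitian_spectral n (X : 'M[C]_n) : adjmx X = X ->
  exists U : 'M[C]_n, exists d : 'rV[R]_n,
  [/\ U *m adjmx U = 1%:M, adjmx U *m U = 1%:M &
      X = adjmx U *m diag_mx (map_mx (real_complex R) d) *m U].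
Proof.
move=> /eqP; rewrite -hermsymmxE => hX.
have hN := hermitian_normalmx hX.
have hU := spectral_unitarymx X; have hu := spectral_unit X.
have aU : adjmx (spectralmx X) = invmx (spectralmx X).
  by rewrite invmx_unitary // /adjmx map_trmx.
exists (spectralmx X); exists (map_mx (@complex.Re R) (spectral_diag X)).
rewrite aU mulVmx // mulmxV //; split => //.
suff -> : map_mx (real_complex R) (map_mx (@complex.Re R) (spectral_diag X))
   = spectral_diag X by apply/orthomx_spectralP.
apply/matrixP => i j; rewrite !mxE RRe_real //.
by have /mxOverP := hermitian_spectral_diag_real hX.
Qed.

Lemma diag_mxE n (d : 'rV[C]_n) i : diag_mx d i i = d 0 i.
Proof. by rewrite mxE eqxx mulr1n. Qed.

Lemma qform_row n (U X : 'M[C]_n) i :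
  qform X (row i U) = (U *m X *m adjmx U) i i.
Proof.
rewrite /qform -row_mul !mxE; apply: eq_bigr => j _; by rewrite !mxE.
Qed.

Lemma psd_factor n (X : 'M[C]_n) : psd X -> exists B : 'M[C]_n, X = B *m adjmx B.
Proof.
move=> hX; have [U [d [UU' U'U eX]]] := hermitian_spectral (psd_adjmx hX).
have dge i : 0 <= d 0 i.
  have : 0 <= qform X (row i U) by apply: psd_qform_ge0.
  rewrite qform_row eX !mulmxA UU' mul1mx -mulmxA UU' mulmx1 diag_mxE mxE.
  by rewrite ler0c.
pose S := diag_mx (map_mx (real_complex R) (map_mx Num.sqrt d)).
exists (adjmx U *m S).
rewrite adjmxM adjmxK !mulmxA eX; congr (_ *m _); rewrite -mulmxA; congr (_ *m _).
apply/matrixP => i j; rewrite mul_diag_mx !mxE; have [<-|nij] := eqVneq i j.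
  rewrite !mulr1n.
  have -> : ((real_complex R (Num.sqrt (d 0 i)))^* = real_complex R (Num.sqrt (d 0 i)))%R.
    by apply/CrealP; rewrite ger0_real // ler0c sqrtr_ge0.
  by rewrite -rmorphM -expr2 sqr_sqrtr.
by rewrite !mulr0n conjC0 mulr0.
Qed.

Lemma tr_mul_psd_ge0 n (X Y : 'M[C]_n) : psd X -> psd Y -> 0 <= \tr (X *m Y).
Proof.
move=> /psd_factor[B ->] hY; rewrite -mulmxA mxtrace_mulC.
rewrite -{2}(adjmxK B).
by apply: psd_tr_ge0; apply: psd_conjugate.
Qed.

End PositiveMatrices.

(** * The trace norm of a traceless hermitian matrix *)

Section TraceNorm.
Variable R : realType.
Local Notation C := R[i].
Local Notation Rez := (@complex.Re R).

Lemma cReD (x y : C) : Rez (x + y) = Rez x + Rez y.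
Proof. by case: x y => [a b] [c d]. Qed.

Lemma cReN (x : C) : Rez (- x) = - Rez x.
Proof. by case: x. Qed.

Lemma cReB (x y : C) : Rez (x - y) = Rez x - Rez y.
Proof. by rewrite cReD cReN. Qed.

Lemma cRe_sum (I : Type) (s : seq I) (P : pred I) (f : I -> C) :
  Rez (\sum_(i <- s | P i) f i) = \sum_(i <- s | P i) Rez (f i).
Proof. by apply: (big_morph Rez cReD). Qed.

Lemma cReMr (x : C) (r : R) : Rez (x * real_complex R r) = Rez x * r.
Proof. by case: x => a b /=; rewrite mulr0 subr0. Qed.

Lemma cReMl (x : C) (r : R) : Rez (real_complex R r * x) = r * Rez x.
Proof. by rewrite mulrC cReMr mulrC. Qed.

Lemma cRe_ge0 (x : C) : 0 <= x -> 0 <= Rez x.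
Proof. by rewrite lecE => /andP[]. Qed.

Lemma mxtraceB n (X Y : 'M[C]_n) : \tr (X - Y) = \tr X - \tr Y.
Proof. exact: raddfB. Qed.

Lemma char_poly_similar n (P Q A : 'M[C]_n) :
  Q *m P = 1%:M -> char_poly (Q *m A *m P) = char_poly A.
Proof.
move=> QP; pose f := @map_mx C {poly C} (@polyC C) n n.
have QPf : f Q *m f P = 1%:M by rewrite /f -map_mxM QP map_mx1.
rewrite /char_poly.
have -> : char_poly_mx (Q *m A *m P) = f Q *m char_poly_mx A *m f P.
  rewrite /char_poly_mx !map_mxM mulmxBr mulmxBl; congr (_ - _).
  by rewrite mul_mx_scalar -scalemxAl QPf scalemx1.
by rewrite !det_mulmx mulrAC -det_mulmx QPf det1 mul1r.
Qed.

Lemma char_poly_diag n (d : 'rV[C]_n) :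
  char_poly (diag_mx d) = \prod_(x <- [seq d 0 i | i <- enum 'I_n]) ('X - x%:P).
Proof.
rewrite char_poly_trig ?diag_mx_is_trig // big_map big_enum /=.
by apply: eq_bigr => i _; rewrite diag_mxE.
Qed.

(** [trnorm] reads eigenvalues off [spectral_diag], whose order is unknown. Two diagonalisations of
    one matrix have the same characteristic polynomial, so their eigenvalues agree up to a
    permutation, which the sum does not see. *)
Lemma trnorm_spectral n (U : 'M[C]_n) (d : 'rV[R]_n) :
  U *m adjmx U = 1%:M -> adjmx U *m U = 1%:M ->
  trnorm (adjmx U *m diag_mx (map_mx (real_complex R) d) *m U) = \sum_i `|d 0 i|.
Proof.
move=> UU' U'U; set D := diag_mx _; set Z := _ *m U.
pose e : 'rV[C]_n := \row_i real_complex R (d 0 i ^+ 2).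
have aD : adjmx D = D.
  apply/matrixP => i j; rewrite adjmxE !mxE eq_sym.
  have [->|_] := eqVneq i j; last by rewrite !mulr0n conjC0.
  by rewrite !mulr1n; apply/CrealP/complex_realP; exists (d 0 j).
have eG : adjmx Z *m Z = adjmx U *m diag_mx e *m U.
  rewrite /Z !adjmxM adjmxK aD !mulmxA; congr (_ *m _).
  rewrite -[_ *m U *m adjmx U]mulmxA UU' mulmx1 -mulmxA; congr (_ *m _).
  rewrite mulmx_diag; congr diag_mx; apply/rowP => i.
  by rewrite !mxE -rmorphM -expr2.
set G := adjmx Z *m Z in eG *.
have hG : G \is hermsymmx by rewrite hermsymmxE adjmxM adjmxK.
have /orthomx_spectralP eG' := hermitian_normalmx hG.
have : perm_eq [seq spectral_diag G 0 i | i <- enum 'I_n] [seq e 0 i | i <- enum 'I_n].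
  apply: prod_XsubC_eq; rewrite -!char_poly_diag.
  rewrite -(@char_poly_similar _ (spectralmx G) (invmx (spectralmx G))).
    by rewrite -eG' eG char_poly_similar.
  by rewrite mulVmx // spectral_unit.
move=> hp; transitivity (\sum_(x <- [seq e 0 i | i <- enum 'I_n]) Num.sqrt (Rez x)).
  by rewrite -(perm_big _ hp) /= big_map big_enum.
rewrite big_map big_enum /=.
by apply: eq_bigr => i _; rewrite mxE /= sqrtr_sqr.
Qed.

Lemma tr_mul_spectral n (E U : 'M[C]_n) (d : 'rV[R]_n) :
  Rez (\tr (E *m (adjmx U *m diag_mx (map_mx (real_complex R) d) *m U)))
  = \sum_i Rez ((U *m E *m adjmx U) i i) * d 0 i.
Proof.
rewrite !mulmxA mxtrace_mulC !mulmxA cRe_sum; apply: eq_bigr => i _.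
by rewrite mul_mx_diag mxE [map_mx _ _ _ _]mxE cReMr.
Qed.

Lemma tr_spectral n (U : 'M[C]_n) (d : 'rV[R]_n) : U *m adjmx U = 1%:M ->
  Rez (\tr (adjmx U *m diag_mx (map_mx (real_complex R) d) *m U)) = \sum_i d 0 i.
Proof.
move=> hU; rewrite -[X in \tr X]mul1mx tr_mul_spectral; apply: eq_bigr => i _.
by rewrite mulmx1 hU !mxE eqxx /= mul1r.
Qed.

Definition effect n (E : 'M[C]_n) := psd E /\ psd (1%:M - E).

Lemma effect_diag n (E U : 'M[C]_n) i : effect E -> U *m adjmx U = 1%:M ->
  0 <= Rez ((U *m E *m adjmx U) i i) <= 1.
Proof.
move=> [hE hE'] hU; apply/andP; split.
  by apply/cRe_ge0/psd_diag_ge0/psd_conjugate.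
have /(psd_diag_ge0 i) /cRe_ge0 := psd_conjugate U hE'.
by rewrite mulmxBr mulmxBl mulmx1 hU entryB cReB !mxE eqxx subr_ge0.
Qed.

(** As the eigenvalues [d] sum to zero, the trace norm is the sum of [|d| + d]. Each term dominates
    [2 x d] for [x] in [0, 1], in particular for the diagonal entry of [E] in the eigenbasis. *)
Lemma effect_le_trnorm n (E Z : 'M[C]_n) :
  adjmx Z = Z -> \tr Z = 0 -> effect E -> 2 * Rez (\tr (E *m Z)) <= trnorm Z.
Proof.
move=> aZ tZ hE; have [U [d [UU' U'U eZ]]] := hermitian_spectral aZ.
have sd : \sum_i d 0 i = 0 by rewrite -(tr_spectral d UU') -eZ tZ.
have -> : trnorm Z = \sum_i (`|d 0 i| + d 0 i).
  by rewrite eZ trnorm_spectral // big_split /= sd addr0.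
rewrite eZ tr_mul_spectral mulr_sumr; apply: ler_sum => i _.
have /andP[e0 e1] := effect_diag i hE UU'.
by have := ler_norm (d 0 i); have := ler_norm (- d 0 i); rewrite normrN; nra.
Qed.

(** The optimal effect is the projection on the eigenvectors with positive eigenvalue. *)
Lemma effect_attains_trnorm n (Z : 'M[C]_n) :
  adjmx Z = Z -> \tr Z = 0 ->
  exists2 E, effect E & trnorm Z = 2 * Rez (\tr (E *m Z)).
Proof.
move=> aZ tZ; have [U [d [UU' U'U eZ]]] := hermitian_spectral aZ.
have sd : \sum_i d 0 i = 0 by rewrite -(tr_spectral d UU') -eZ tZ.
pose P (p : 'I_n -> bool) : 'M[C]_n := diag_mx (\row_i (p i)%:R).
have psdP p : psd (adjmx U *m P p *m U).
  rewrite -{2}(adjmxK U); apply: psd_conjugate; apply: psd_qform => v.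
  rewrite /qform mul_mx_diag mxE; apply: sumr_ge0 => i _.
  by rewrite adjmxE !mxE mulrAC mulr_ge0 ?ler0n ?mul_conjC_ge0.
exists (adjmx U *m P (fun i => 0 < d 0 i) *m U).
  split => //; suff -> : 1%:M - adjmx U *m P (fun i => 0 < d 0 i) *m U
     = adjmx U *m P (fun i => ~~ (0 < d 0 i)) *m U by [].
  apply/eqP; rewrite subr_eq -mulmxDl -mulmxDr; apply/eqP.
  suff -> : P (fun i => ~~ (0 < d 0 i)) + P (fun i => 0 < d 0 i) = 1%:M.
    by rewrite mulmx1.
  apply/matrixP => i j; rewrite !mxE; have [->|_] := eqVneq i j; last first.
    by rewrite addr0.
  by case: (0 < d 0 j); rewrite /= ?addr0 ?add0r.
have -> : trnorm Z = \sum_i (`|d 0 i| + d 0 i).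
  by rewrite eZ trnorm_spectral // big_split /= sd addr0.
rewrite eZ tr_mul_spectral mulr_sumr; apply: eq_bigr => i _.
rewrite !mulmxA UU' mul1mx -mulmxA UU' mulmx1 diag_mxE mxE.
case: (ltrP 0 (d 0 i)) => h /=.
  by rewrite gtr0_norm // mul1r mulr2n mulrDl mul1r.
by rewrite ler0_norm // addNr mul0r mulr0.
Qed.

Lemma trnormN n (Z : 'M[C]_n) : trnorm (- Z) = trnorm Z.
Proof. by rewrite /trnorm adjmxN mulNmx mulmxN opprK. Qed.

End TraceNorm.

(** * Choi matrices, complete positivity and test operators *)

Section ChoiMatrices.
Variable R : realType.
Local Notation C := R[i].
Local Notation Rez := (@complex.Re R).
Local Notation ix i k := (mxtens_index (i, k)).

Lemma sum_mxtens (V : nmodType) m n (F : 'I_(m * n) -> V) :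
  \sum_x F x = \sum_i \sum_k F (ix i k).
Proof.
rewrite pair_bigA /= (reindex (@mxtens_index m n)); last first.
  by exists (@mxtens_unindex m n) => x _; rewrite (mxtens_indexK, mxtens_unindexK).
by apply: eq_bigr => -[].
Qed.

Lemma mxtens_matrixP m n p q (X Y : 'M[C]_(m * n, p * q)) :
  (forall i k j l, X (ix i k) (ix j l) = Y (ix i k) (ix j l)) -> X = Y.
Proof.
move=> h; apply/matrixP => x y.
by rewrite -[x]mxtens_unindexK -[y]mxtens_unindexK; case: mxtens_unindex;
   case: mxtens_unindex => *.
Qed.

(** [tens_id f] applies [f] to each block with fixed indices in the second factor; [blockl] plays
    this role for [id_tens]. *)
Definition blockr m k (X : 'M[C]_(m * k)) a b : 'M[C]_m :=
  \matrix_(i, j) X (ix i a) (ix j b).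

Definition blockl u m (X : 'M[C]_(u * m)) a b : 'M[C]_m :=
  \matrix_(i, j) X (ix a i) (ix b j).

Lemma tens_idE m n k (f : 'M[C]_m -> 'M[C]_n) (X : 'M[C]_(m * k)) p a q b :
  tens_id f X (ix p a) (ix q b) = f (blockr X a b) p q.
Proof.
rewrite summxE (bigD1 a) //= summxE (bigD1 b) //= tensmxE [delta_mx _ _ _ _]mxE.
rewrite !eqxx mulr1 big1 => [|c nc]; last first.
  by rewrite tensmxE [delta_mx _ _ _ _]mxE [b == c]eq_sym (negPf nc) andbF mulr0.
rewrite addr0 big1 ?addr0 // => c nc; rewrite summxE big1 // => d _.
by rewrite tensmxE [delta_mx _ _ _ _]mxE eq_sym (negPf nc) mulr0.
Qed.

Lemma id_tensE m n u (f : 'M[C]_m -> 'M[C]_n) (X : 'M[C]_(u * m)) a p b q :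
  id_tens f X (ix a p) (ix b q) = f (blockl X a b) p q.
Proof.
rewrite summxE (bigD1 a) //= summxE (bigD1 b) //= tensmxE [delta_mx _ _ _ _]mxE.
rewrite !eqxx mul1r big1 => [|c nc]; last first.
  by rewrite tensmxE [delta_mx _ _ _ _]mxE [b == c]eq_sym (negPf nc) andbF mul0r.
rewrite addr0 big1 ?addr0 // => c nc; rewrite summxE big1 // => d _.
by rewrite tensmxE [delta_mx _ _ _ _]mxE eq_sym (negPf nc) mul0r.
Qed.

Lemma maxent_gramE n i k j l :
  (maxent R n *m adjmx (maxent R n)) (ix i k) (ix j l) = ((i == k) && (j == l))%:R.
Proof.
have E x y : maxent R n (ix x y) 0 = (x == y)%:R.
  rewrite summxE (bigD1 x) //= mxE mxtens_indexK !mxE !ord1 !eqxx mul1r big1 ?addr0.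
    by rewrite andbT eq_sym.
  by move=> c nc; rewrite mxE mxtens_indexK !mxE eq_sym (negPf nc) mul0r.
rewrite mxE big_ord1 adjmxE !E; case: (i == k); case: (j == l);
  by rewrite ?conjC1 ?conjC0 ?mulr1 ?mulr0.
Qed.

Lemma blockr_maxent n a b :
  blockr (maxent R n *m adjmx (maxent R n)) a b = delta_mx a b.
Proof. by apply/matrixP => i j; rewrite mxE maxent_gramE mxE. Qed.

(* Transposing the tensor factors and conjugating, this is the usual Choi matrix:
   [chmx f] has entries conj(f(E_ij)_kl), so that the pairing reads Tr[X chmx f]. *)
Definition chmx m n (f : lmap R m n) : 'M[C]_(m * n) := choi (hs_adj f).

Lemma chmxE m n (f : lmap R m n) i k j l :
  chmx f (ix i k) (ix j l) = (f (delta_mx i j) k l)^*.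
Proof.
rewrite /chmx /choi tens_idE blockr_maxent mxE -adjmxE /mxtrace.
rewrite (bigD1 l) //= mxE (bigD1 k) //= [delta_mx _ _ _ _]mxE !eqxx mulr1.
rewrite big1 => [|x nx]; last by rewrite !mxE (negPf nx) mulr0.
rewrite addr0 big1 ?addr0 // => x nx; rewrite mxE big1 // => y _.
by rewrite !mxE (negPf nx) andbF mulr0.
Qed.

Lemma pairingE m n (X : 'M[C]_(m * n)) (f : lmap R m n) :
  pairing X f = \tr (X *m chmx f).
Proof. by []. Qed.

Lemma lmap_delta m n (f : lmap R m n) X :
  f X = \sum_i \sum_j X i j *: f (delta_mx i j).
Proof.
rewrite {1}(matrix_sum_delta X) linear_sum; apply: eq_bigr => i _.
by rewrite linear_sum; apply: eq_bigr => j _; rewrite linearZ.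
Qed.

Lemma lmapE m n (f : lmap R m n) X p q :
  f X p q = \sum_i \sum_j X i j * f (delta_mx i j) p q.
Proof.
rewrite {1}lmap_delta summxE; apply: eq_bigr => i _; rewrite summxE.
by apply: eq_bigr => j _; rewrite entryZ.
Qed.

(** Inverse of the Choi correspondence: the conjugate undoes the one in [chmx]. *)
Definition chfun m n (M : 'M[C]_(m * n)) (X : 'M[C]_m) : 'M[C]_n :=
  \matrix_(k, l) \sum_i \sum_j X i j * (M (ix i k) (ix j l))^*.

Fact chfun_is_linear m n (M : 'M[C]_(m * n)) : linear (chfun M).
Proof.
move=> a X Y; apply/matrixP => k l; rewrite !mxE mulr_sumr -big_split /=.
apply: eq_bigr => i _; rewrite mulr_sumr -big_split /=.
by apply: eq_bigr => j _; rewrite !mxE mulrDl mulrA.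
Qed.

HB.instance Definition _ m n (M : 'M[C]_(m * n)) :=
  GRing.isLinear.Build C 'M[C]_m 'M[C]_n _ (chfun M) (chfun_is_linear M).

Definition chmap m n (M : 'M[C]_(m * n)) : lmap R m n := linfun (chfun M).

Lemma chmapE m n (M : 'M[C]_(m * n)) X k l :
  chmap M X k l = \sum_i \sum_j X i j * (M (ix i k) (ix j l))^*.
Proof. by rewrite lfunE mxE. Qed.

Lemma chmap_delta m n (M : 'M[C]_(m * n)) i j k l :
  chmap M (delta_mx i j) k l = (M (ix i k) (ix j l))^*.
Proof.
rewrite chmapE (bigD1 i) //= (bigD1 j) //= !mxE !eqxx mul1r.
rewrite big1 => [|x nx]; last by rewrite !mxE (negPf nx) andbF mul0r.
rewrite addr0 big1 ?addr0 // => x nx; rewrite big1 // => y _.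
by rewrite !mxE (negPf nx) mul0r.
Qed.

Lemma chmapK m n (M : 'M[C]_(m * n)) : chmx (chmap M) = M.
Proof. by apply: mxtens_matrixP => i k j l; rewrite chmxE chmap_delta conjCK. Qed.

Lemma chmxK m n (f : lmap R m n) : chmap (chmx f) = f.
Proof.
apply/lfunP => X; apply/matrixP => k l; rewrite chmapE lmapE.
by apply: eq_bigr => i _; apply: eq_bigr => j _; rewrite chmxE conjCK.
Qed.

Lemma chmxB m n (f g : lmap R m n) : chmx (f - g) = chmx f - chmx g.
Proof.
apply: mxtens_matrixP => i k j l; rewrite [RHS]entryB.
rewrite [X in _ = X - _]chmxE [X in _ = _ - X]chmxE [LHS]chmxE.
have -> : (f - g) (delta_mx i j) = f (delta_mx i j) - g (delta_mx i j).
  by rewrite add_lfunE opp_lfunE.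
by rewrite entryB rmorphB.
Qed.

Lemma chmxD m n (f g : lmap R m n) : chmx (f + g) = chmx f + chmx g.
Proof.
apply: mxtens_matrixP => i k j l.
rewrite [RHS]entryD [X in _ = X + _]chmxE [X in _ = _ + X]chmxE [LHS]chmxE.
have -> : (f + g) (delta_mx i j) = f (delta_mx i j) + g (delta_mx i j).
  by rewrite add_lfunE.
by rewrite entryD rmorphD.
Qed.

Lemma chmxZ m n a (f : lmap R m n) : chmx (a *: f) = a^* *: chmx f.
Proof.
apply: mxtens_matrixP => i k j l.
rewrite [RHS]entryZ [X in _ = _ * X]chmxE [LHS]chmxE.
by rewrite scale_lfunE entryZ rmorphM.
Qed.

(** Complete positivity is tested on the unnormalised maximally entangled operator. Its image is
    hermitian, so the conjugate in [chmx] amounts to a transpose, and [s] swaps the tensor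
    factors. *)
Lemma CP_psd_chmx m n (f : lmap R m n) : CPmap f -> psd (chmx f).
Proof.
move=> hf; have hO : psd (maxent R m *m adjmx (maxent R m)) by apply: psd_gram.
have hT := hf _ _ hO; set T := tens_id _ _ in hT.
pose s (x : 'I_(m * n)) : 'I_(n * m) :=
  ix (mxtens_unindex x).2 (mxtens_unindex x).1.
suff -> : chmx f = mxsub s s T^T by apply/psd_mxsub/psd_trmx.
apply: mxtens_matrixP => i k j l; rewrite chmxE !mxE /s !mxtens_indexK /=.
by rewrite -(psd_adjmx hT) adjmxE /T tens_idE blockr_maxent.
Qed.

(** Kraus decomposition: column [r] of a factor [B] of the Choi matrix, conjugated and reshaped, is
    a Kraus operator, and [A r] is its tensor product with the identity of size [k]. *)
Lemma psd_chmx_CP m n (f : lmap R m n) : psd (chmx f) -> CPmap f.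
Proof.
move=> hf k X hX; have [B eB] := psd_factor hf.
pose A r : 'M[C]_(n * k, m * k) := \matrix_(x < n * k, y < m * k)
  ((B (ix (mxtens_unindex y).1 (mxtens_unindex x).1) r)^* *+
  ((mxtens_unindex x).2 == (mxtens_unindex y).2))%R.
have AE r p a i b : A r (ix p a) (ix i b) = (B (ix i p) r)^* *+ (a == b).
  by rewrite mxE !mxtens_indexK.
suff -> : tens_id f X = \sum_r A r *m X *m adjmx (A r).
  by apply: psd_sum => r _; apply: psd_conjugate.
apply: mxtens_matrixP => p a q b; rewrite tens_idE lmapE summxE.
transitivity (\sum_r \sum_j \sum_i
    (B (ix i p) r)^* * X (ix i a) (ix j b) * B (ix j q) r); last first.
  apply: eq_bigr => r _; rewrite mxE sum_mxtens; apply: eq_bigr => j _.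
  rewrite (bigD1 b) //= [X in _ = _ + X]big1 ?addr0 => [|c nc]; last first.
    by rewrite adjmxE AE eq_sym (negPf nc) mulr0n conjC0 mulr0.
  rewrite adjmxE AE eqxx mulr1n conjCK mxE sum_mxtens mulr_suml.
  apply: eq_bigr => i _; rewrite (bigD1 a) //= AE eqxx mulr1n big1 ?mulrDl ?mul0r ?addr0 //.
  by move=> c nc; rewrite AE eq_sym (negPf nc) mulr0n mul0r.
rewrite [LHS]exchange_big [RHS]exchange_big /=; apply: eq_bigr => j _.
rewrite [RHS]exchange_big /=; apply: eq_bigr => i _.
have -> : f (delta_mx i j) p q = (chmx f (ix i p) (ix j q))^* by rewrite chmxE conjCK.
rewrite eB [X in X^*]mxE rmorph_sum mulr_sumr; apply: eq_bigr => r _.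
by rewrite mxE adjmxE rmorphM /= conjCK mulrA [X in X * _]mulrC.
Qed.

Lemma chmap_CP m n (M : 'M[C]_(m * n)) : psd M -> CPmap (chmap M).
Proof. by move=> hM; apply: psd_chmx_CP; rewrite chmapK. Qed.

Definition ptrace m n (M : 'M[C]_(m * n)) : 'M[C]_m :=
  \matrix_(i, j) \sum_k M (ix i k) (ix j k).

Lemma tr_ptrace m n (M : 'M[C]_(m * n)) : \tr (ptrace M) = \tr M.
Proof. by rewrite /mxtrace sum_mxtens; apply: eq_bigr => i _; rewrite mxE. Qed.

Lemma tr_lmap m n (f : lmap R m n) X :
  \tr (f X) = \sum_i \sum_j X i j * (ptrace (chmx f) i j)^*.
Proof.
rewrite /mxtrace; under eq_bigr do rewrite lmapE.
rewrite exchange_big; apply: eq_bigr => i _; rewrite exchange_big.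
apply: eq_bigr => j _; rewrite mxE rmorph_sum mulr_sumr; apply: eq_bigr => k _.
by rewrite chmxE; congr (_ * _); rewrite -[RHS]/(_^*) conjCK.
Qed.

Lemma TP_ptrace m n (f : lmap R m n) : ptrace (chmx f) = 1%:M -> TPmap f.
Proof.
move=> hf X; rewrite tr_lmap; apply: eq_bigr => i _.
rewrite (bigD1 i) //= hf mxE eqxx conjC1 mulr1 big1 ?addr0 // => j nj.
by rewrite mxE eq_sym (negPf nj) conjC0 mulr0.
Qed.

Lemma ptrace_TP m n (f : lmap R m n) : TPmap f -> ptrace (chmx f) = 1%:M.
Proof.
move=> hf; apply/matrixP => i j; rewrite mxE.
transitivity ((\tr (f (delta_mx i j)))^*).
  by rewrite rmorph_sum; apply: eq_bigr => k _; rewrite chmxE.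
rewrite hf /mxtrace [RHS]mxE (bigD1 i) //= mxE eqxx big1 => [|k nk].
  by rewrite addr0; case: eqP; rewrite /= ?conjC1 ?conjC0.
by rewrite mxE (negPf nk).
Qed.

Lemma tr_tens_id m n k (f : lmap R m n) (X : 'M[C]_(m * k)) :
  TPmap f -> \tr (tens_id f X) = \tr X.
Proof.
move=> hf; rewrite /mxtrace !sum_mxtens exchange_big [RHS]exchange_big /=.
apply: eq_bigr => a _; under eq_bigr do rewrite tens_idE.
by rewrite -/(\tr _) hf; apply: eq_bigr => i _; rewrite mxE.
Qed.

Lemma tens_idB m n k (f g : lmap R m n) (X : 'M[C]_(m * k)) :
  tens_id (f - g) X = tens_id f X - tens_id g X.
Proof.
apply: mxtens_matrixP => p a q b.
by rewrite entryB !tens_idE add_lfunE opp_lfunE entryB.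
Qed.

Lemma chmx_channel_tr m n (f : lmap R m n) : channel f -> \tr (chmx f) = m%:R.
Proof. by case=> _ /ptrace_TP h; rewrite -tr_ptrace h mxtrace1. Qed.

(* The operator whose pairing with a map [g] is Tr[E (g (x) id)(rho)]. *)
Definition testop m n k (E : 'M[C]_(n * k)) (rho : 'M[C]_(m * k)) : 'M[C]_(m * n) :=
  \matrix_(x, y) \sum_a \sum_b
    E (ix (mxtens_unindex y).2 b) (ix (mxtens_unindex x).2 a)
    * rho (ix (mxtens_unindex x).1 a) (ix (mxtens_unindex y).1 b).

Lemma testopE m n k (E : 'M[C]_(n * k)) (rho : 'M[C]_(m * k)) i p j q :
  testop E rho (ix i p) (ix j q)
  = \sum_a \sum_b E (ix q b) (ix p a) * rho (ix i a) (ix j b).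
Proof. by rewrite mxE !mxtens_indexK. Qed.

Lemma sum6_perm (I J K : finType) (F : I -> K -> I -> K -> J -> J -> C) :
  \sum_i \sum_p \sum_j \sum_q \sum_a \sum_b F i p j q a b
  = \sum_q \sum_b \sum_p \sum_a \sum_i \sum_j F i p j q a b.
Proof.
rewrite !pair_bigA /=.
rewrite (reindex (fun x : K * J * K * J * I * I =>
   let: (q, b, p, a, i, j) := x in (i, p, j, q, a, b))) /=.
  by apply: eq_bigr => -[[[[[? ?] ?] ?] ?] ?].
by exists (fun x => let: (i, p, j, q, a, b) := x in (q, b, p, a, i, j));
  move=> [[[[[? ?] ?] ?] ?] ?].
Qed.

Lemma tr_testop m n k (E : 'M[C]_(n * k)) (rho : 'M[C]_(m * k)) (g : lmap R m n) :
  psd (chmx g) -> pairing (testop E rho) g = \tr (E *m tens_id g rho).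
Proof.
move=> hg; rewrite pairingE.
(* Hermiticity of the Choi matrix trades the conjugate in [chmx] for exchanged indices. *)
have gE i j p q : chmx g (ix j q) (ix i p) = g (delta_mx i j) p q.
  by rewrite -(psd_adjmx hg) adjmxE chmxE conjCK.
transitivity (\sum_i \sum_p \sum_j \sum_q \sum_a \sum_b
    E (ix q b) (ix p a) * rho (ix i a) (ix j b) * g (delta_mx i j) p q).
  rewrite /mxtrace sum_mxtens; apply: eq_bigr => i _; apply: eq_bigr => p _.
  rewrite mxE sum_mxtens; apply: eq_bigr => j _; apply: eq_bigr => q _.
  rewrite testopE gE mulr_suml; apply: eq_bigr => a _; rewrite mulr_suml.
  by apply: eq_bigr.
rewrite sum6_perm /mxtrace sum_mxtens; apply: eq_bigr => q _; apply: eq_bigr => b _.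
rewrite mxE sum_mxtens; apply: eq_bigr => p _; apply: eq_bigr => a _.
rewrite tens_idE lmapE mulr_sumr; apply: eq_bigr => i _; rewrite mulr_sumr.
by apply: eq_bigr => j _; rewrite mxE mulrA.
Qed.

Lemma qform_tr n (X : 'M[C]_n) v : qform X v = \tr (X *m (adjmx v *m v)).
Proof. by rewrite /qform mulmxA [RHS]mxtrace_mulC mulmxA -trace_mx11. Qed.

(** Every rank-one operator [adjmx v *m v] is the Choi matrix of a completely positive map, so the
    pairings include all values of the quadratic form. *)
Lemma psd_pairing m n (X : 'M[C]_(m * n)) :
  (forall f : lmap R m n, CPmap f -> 0 <= pairing X f) -> psd X.
Proof.
move=> hX; apply: psd_qform => v; rewrite qform_tr -[_ *m v]chmapK; apply: hX.
by apply: chmap_CP; rewrite -{2}(adjmxK v); apply: psd_gram.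
Qed.

Lemma pairing_ge0 m n (X : 'M[C]_(m * n)) (f : lmap R m n) :
  psd X -> CPmap f -> 0 <= pairing X f.
Proof. by move=> hX /CP_psd_chmx; apply: tr_mul_psd_ge0. Qed.

Lemma pairingB m n (X : 'M[C]_(m * n)) (f g : lmap R m n) :
  pairing X (f - g) = pairing X f - pairing X g.
Proof. by rewrite !pairingE chmxB mulmxBr linearB. Qed.

End ChoiMatrices.

(** * An approximate minimax theorem *)

Section Minimax.
Variable R : realType.
Local Notation C := R[i].
Local Notation Rez := (@complex.Re R).
Local Notation Imz := (@complex.Im R).

(* Minimising the sum of the squares of the positive parts over the convex set [K]:
   near the infimum, the positive parts are weights against which some point of [K]
   responds well, and moving towards that point lowers the sum. *)
Lemma finite_minimax (S : Type) (J : finType) (K : set S) (g : J -> S -> R) (c B : R) :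
  K !=set0 ->
  (forall f0 f1 t, K f0 -> K f1 -> 0 <= t <= 1 ->
    exists2 f, K f & forall j, g j f = (1 - t) * g j f0 + t * g j f1) ->
  (forall j f, K f -> `|g j f| <= B) ->
  (forall p : J -> R, (forall j, 0 <= p j) -> \sum_j p j = 1 -> forall e, 0 < e ->
    exists2 f, K f & \sum_j p j * g j f <= c + e) ->
  forall e, 0 < e -> exists2 f, K f & forall j, g j f <= c + e.
Proof.
move=> [f00 Kf00] convK bdK resp e e0.
pose h j f := g j f - c; pose a j f := Num.max (h j f) 0.
pose Phi f := \sum_j a j f ^+ 2; pose E := [set Phi f | f in K].
have a0 j f : 0 <= a j f by rewrite le_max lexx orbT.
have ha j f : h j f <= a j f by rewrite le_max lexx.
have Phi0 f : 0 <= Phi f by apply: sumr_ge0 => j _; apply: sqr_ge0.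
pose B' := `|B| + `|c|.
have B'0 : 0 <= B' by rewrite addr_ge0.
have hB j f : K f -> `|h j f| <= B'.
  move=> Kf; rewrite (le_trans (ler_normB _ _)) // lerD2r.
  by rewrite (le_trans (bdK _ _ Kf)) // ler_norm.
have aB j f : K f -> a j f <= B'.
  by move=> Kf; rewrite ge_max B'0 andbT (le_trans (ler_norm _)) // hB.
pose N := #|J|%:R * B' ^+ 2; pose A := #|J|%:R * B'.
have N0 : 0 <= N by rewrite mulr_ge0 ?ler0n ?sqr_ge0.
have A0 : 0 <= A by rewrite mulr_ge0 ?ler0n.
have sumA f : K f -> \sum_j a j f <= A.
  move=> Kf; rewrite /A -sum1_card natr_sum mulr_suml; apply: ler_sum => j _.
  by rewrite mul1r aB.
have sumN f : K f -> \sum_j h j f ^+ 2 <= N.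
  move=> Kf; rewrite /N -sum1_card natr_sum mulr_suml; apply: ler_sum => j _.
  by rewrite mul1r -real_normK ?num_real // lerXn2r ?nnegrE ?hB.
(* The weights are the normalised positive parts at [f0]. A response to them makes the cross term at
   most [s * A], so the decrease of [Phi] is of first order in [t] and the error [t ^+ 2 * N] of
   second order. *)
have step f0 t s : K f0 -> 0 <= t <= 1 -> 0 < s -> 0 < Phi f0 ->
    exists2 f, K f & Phi f <= (1 - t) ^+ 2 * Phi f0 + 2 * t * s * A + t ^+ 2 * N.
  move=> Kf0 t01 s0 P0.
  have Sa : 0 < \sum_j a j f0.
    rewrite lt_def sumr_ge0 // andbT; apply/eqP => /eqP.
    rewrite psumr_eq0 // => /allP z; move: P0; rewrite /Phi big1 ?ltxx // => j _.
    by have /eqP -> := z j (mem_index_enum j); rewrite expr0n.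
  have [||f1 Kf1 hf1] := resp (fun j => a j f0 / \sum_j a j f0) _ _ s s0.
  - by move=> j; rewrite divr_ge0 // ltW.
  - by rewrite -mulr_suml divff // gt_eqF.
  have {}hf1 : \sum_j a j f0 * h j f1 <= s * A.
    have : \sum_j a j f0 * h j f1 <= s * \sum_j a j f0.
      set Sm := \sum_j a j f0 in Sa hf1 *.
      have e1 : \sum_j a j f0 / Sm * g j f1 = Sm^-1 * \sum_j a j f0 * g j f1.
        by rewrite mulr_sumr; apply: eq_bigr => j _; rewrite mulrAC mulrC.
      have -> : \sum_j a j f0 * h j f1 = \sum_j a j f0 * g j f1 - Sm * c.
        rewrite mulr_suml -sumrB; apply: eq_bigr => j _; exact: mulrBr.
      move: hf1; rewrite e1 ler_pdivrMl // mulrDr => hf1.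
      by rewrite lerBlDl [s * _]mulrC.
    by move/le_trans; apply; rewrite ler_pM2l // sumA.
  have [f Kf hf] := convK _ _ _ Kf0 Kf1 t01; exists f => //.
  have /andP[t0 t1] := t01.
  have : Phi f <= \sum_j ((1 - t) ^+ 2 * a j f0 ^+ 2 +
      2 * t * (1 - t) * (a j f0 * h j f1) + t ^+ 2 * h j f1 ^+ 2).
    apply: ler_sum => j _.
    have -> : (1 - t) ^+ 2 * a j f0 ^+ 2 + 2 * t * (1 - t) * (a j f0 * h j f1) +
       t ^+ 2 * h j f1 ^+ 2 = ((1 - t) * a j f0 + t * h j f1) ^+ 2 by ring.
    (* Only the term at [f0] is replaced by its positive part: the response controls the weighted
       sum of [h j f1], not of positive parts. *)
    have le : h j f <= (1 - t) * a j f0 + t * h j f1.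
      have -> : h j f = (1 - t) * h j f0 + t * h j f1 by rewrite /h hf; ring.
      by rewrite lerD2r ler_wpM2l // subr_ge0.
    rewrite /a; case: (leP (h j f) 0) => [_|hp].
      by rewrite expr0n sqr_ge0.
    by rewrite lerXn2r // ?nnegrE; [apply: ltW | apply: le_trans le; apply: ltW].
  move/le_trans; apply; rewrite !big_split /= -!mulr_sumr.
  have h1 := sumN _ Kf1.
  apply: lerD; last by rewrite ler_wpM2l // sqr_ge0.
  rewrite lerD2l -!mulrA ler_wpM2l // ler_wpM2l //.
  have sA : 0 <= s * A by rewrite mulr_ge0 // ltW.
  have [p|n] := leP 0 (\sum_j a j f0 * h j f1).
    by apply: le_trans hf1; rewrite ler_piMl // gerBl.
  by apply: le_trans sA; rewrite mulr_ge0_le0 ?subr_ge0 // ltW.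
have E0 : has_inf E.
  by split; [exists (Phi f00), f00 | exists 0 => _ [f _ <-]].
have d0 : inf E <= 0.
  rewrite leNgt; apply/negP; set d := inf E => dgt.
  (* [t] and [s] keep [t * N] and [2 * s * A] below [d / 4]. From a point with
     [Phi f0 < d + t * d / 4] the step then reaches at most [(1 - t) * Phi f0 + t * d / 2], strictly
     below the infimum [d]. *)
  pose t := d / (4 * (N + 1) + d).
  have den : 0 < 4 * (N + 1) + d by lra.
  have t0 : 0 < t by rewrite divr_gt0.
  have t1 : t < 1 by rewrite ltr_pdivrMr //; lra.
  have tN : t * N <= d / 4.
    by rewrite mulrAC ler_pdivrMr //; nra.
  pose s := d / (8 * (A + 1)).
  have s0 : 0 < s by rewrite divr_gt0 //; lra.
  have sA : 2 * s * A <= d / 4.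
    have -> : 2 * s * A = (2 * d * A) / (8 * (A + 1)) by rewrite /s; ring.
    by rewrite ler_pdivrMr; nra.
  have td : 0 < t * d / 4 by rewrite divr_gt0 // mulr_gt0.
  have [_ [f0 Kf0 <-] Pf0] := inf_adherent td E0.
  have dP : d <= Phi f0 by apply: ge_inf; [case: E0 | exists f0].
  have [||f Kf Pf] := step f0 t s Kf0 _ s0.
  - by rewrite !ltW.
  - exact: lt_le_trans dP.
  have : d <= Phi f by apply: ge_inf; [case: E0 | exists f].
  rewrite -/d in Pf0; move: (Phi f) (Phi f0) Pf Pf0 dP => x y Pf Pf0 dP dx.
  have l1 : (1 - t) ^+ 2 * y <= (1 - t) * y.
    by rewrite expr2 -mulrA ler_piMl ?mulr_ge0 //; lra.
  have l2 : 2 * t * s * A = t * (2 * s * A) by ring.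
  have l3 : t ^+ 2 * N = t * (t * N) by ring.
  rewrite l2 l3 in Pf.
  have l4 : t * (2 * s * A) <= t * (d / 4) by rewrite ler_pM2l.
  have l5 : t * (t * N) <= t * (d / 4) by rewrite ler_pM2l.
  have arith (d' x' y' q u z1 z2 z3 : R) : z3 <= y' - u -> z1 <= q -> z2 <= q ->
      4 * q <= u -> x' <= z3 + z1 + z2 -> d' <= x' -> y' < d' + q -> 0 < q -> False.
    by move=> *; lra.
  rewrite mulrBl mul1r in l1; rewrite [t * (d / 4)]mulrA in l4; rewrite [t * (d / 4)]mulrA in l5.
  apply: (arith _ _ _ _ _ _ _ _ l1 l4 l5 _ Pf dx Pf0 td).
  by rewrite mulrC divfK // ler_pM2l.
have e20 : 0 < e ^+ 2 by rewrite exprn_gt0.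
have [_ [f Kf <-] Pf] := inf_adherent e20 E0.
exists f => // j; rewrite -lerBlDl -/(h j f) (le_trans (ha j f)) //.
rewrite -(@ler_pXn2r _ 2) ?nnegrE // ?(ltW e0) //; apply: (@le_trans _ _ (Phi f)).
  by rewrite /Phi (bigD1 j) //= lerDl sumr_ge0 // => i _; apply: sqr_ge0.
by rewrite ltW // (lt_le_trans Pf) // gerDr.
Qed.

(** Coordinates are rounded to a grid of side [d], and the net is indexed by all cells. A cell is
    represented by a point of [D] in it or, when there is none, by an arbitrary point of [D], so
    that the net stays inside [D]. *)
Lemma bounded_coord_net (T : Type) (L : finType) (x : T -> L -> R) (D : set T) (B d : R) :
  D !=set0 -> (forall y l, D y -> `|x y l| <= B) -> 0 < d ->
  exists (J : finType) (w : J -> T), (forall j, D (w j)) /\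
    forall y, D y -> exists j, forall l, `|x y l - x (w j) l| <= d.
Proof.
move=> [y0 Dy0] bd d0.
pose tr (r : R) := Num.trunc ((r + B) / d).
pose k := Num.trunc ((B + B) / d).
pose cell y : {ffun L -> 'I_k.+1} := [ffun l => inord (tr (x y l))].
have : forall j, exists y', D y' /\ ((exists2 y, D y & cell y = j) -> cell y' = j).
  move=> j.
  have [[y Dy <-]|n] := pselect (exists2 y, D y & cell y = j); first by exists y.
  by exists y0.
move=> /choice[w hw].
exists {ffun L -> 'I_k.+1}, w; split=> [j|y Dy]; first by case: (hw j).
exists (cell y) => l; have [Dw hc] := hw (cell y).
have {}hc : cell (w (cell y)) = cell y by apply: hc; exists y.
set z := w _ in Dw hc *.
have nn u : D u -> 0 <= (x u l + B) / d.
  move=> Du; rewrite divr_ge0 ?(ltW d0) //.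
  by have := bd _ l Du; rewrite ler_norml => /andP[]; lra.
have small u : D u -> (tr (x u l) < k.+1)%N.
  move=> Du; rewrite ltnS /tr /k; apply: le_truncn.
  rewrite ler_pM2r ?invr_gt0 // lerD2r.
  by rewrite (le_trans (ler_norm _)) // bd.
have eqt : tr (x z l) = tr (x y l).
  have := congr1 (fun F : {ffun L -> 'I_k.+1} => val (F l)) hc.
  by rewrite /= !ffunE !inordK ?small.
have /andP[y1 y2] := truncn_itv (nn _ Dy).
have /andP[z1 z2] := truncn_itv (nn _ Dw).
rewrite -/(tr _) in y1 y2; rewrite -/(tr _) eqt in z1 z2.
rewrite ler_pdivlMr // in y1; rewrite ler_pdivlMr // in z1.
rewrite ltr_pdivrMr // in y2; rewrite ltr_pdivrMr // in z2.
by rewrite -natr1 in y2 z2; rewrite ler_norml; apply/andP; split; nra.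
Qed.

Lemma Re_tr_mul n (X Y : 'M[C]_n) : Rez (\tr (X *m Y)) =
  \sum_i \sum_j (Rez (X i j) * Rez (Y j i) - Imz (X i j) * Imz (Y j i)).
Proof.
rewrite cRe_sum; apply: eq_bigr => i _; rewrite mxE cRe_sum; apply: eq_bigr => j _.
by case: (X i j) (Y j i) => [a b] [u v].
Qed.

Lemma Re_norm_le (z : C) (b : R) : `|z| <= real_complex R b -> `|Rez z| <= b.
Proof.
rewrite normc_def lecR; apply: le_trans.
by rewrite -sqrtr_sqr ler_wsqrtr // lerDl sqr_ge0.
Qed.

Lemma Im_norm_le (z : C) (b : R) : `|z| <= real_complex R b -> `|Imz z| <= b.
Proof.
rewrite normc_def lecR; apply: le_trans.
by rewrite -sqrtr_sqr ler_wsqrtr // lerDr sqr_ge0.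
Qed.

Lemma Re_tr_mul_le n (X Y : 'M[C]_n) (d b : R) :
  (forall i j, `|Rez (X i j)| <= d) -> (forall i j, `|Imz (X i j)| <= d) ->
  (forall i j, `|Y i j| <= real_complex R b) ->
  `|Rez (\tr (X *m Y))| <= (n * n)%:R * (2 * d * b).
Proof.
move=> hR hI hY; rewrite Re_tr_mul.
apply: (@le_trans _ _ (\sum_(i < n) \sum_(j < n) (2 * d * b))); last first.
  by rewrite !sumr_const !card_ord -mulrnA [(n * n)%:R * _]mulr_natl.
rewrite (le_trans (ler_norm_sum _ _ _)) //; apply: ler_sum => i _.
rewrite (le_trans (ler_norm_sum _ _ _)) //; apply: ler_sum => j _.
rewrite (le_trans (ler_normB _ _)) // !normrM.
have -> : 2 * d * b = d * b + d * b by ring.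
by apply: lerD; apply: ler_pM => //; [apply: Re_norm_le | apply: Im_norm_le].
Qed.

Lemma mxtrace_sum n (I : Type) (s : seq I) (P : pred I) (F : I -> 'M[C]_n) :
  \tr (\sum_(i <- s | P i) F i) = \sum_(i <- s | P i) \tr (F i).
Proof. exact: (big_morph _ (@mxtraceD _ n) (mxtrace0 _ _)). Qed.

Definition bounded_mxset n (D : set 'M[C]_n) (b : R) :=
  forall X, D X -> forall i j, `|X i j| <= real_complex R b.

(** [D] is replaced by a finite net. Weighted means of the net lie in [D], so responses to single
    tests are responses to weights. Boundedness of [K] makes the pairing Lipschitz in [X] uniformly
    over [K], which carries the bound from the net to [D]. *)
Lemma matrix_minimax n (D K : set 'M[C]_n) (bD bK c : R) :
  K !=set0 -> bounded_mxset D bD -> bounded_mxset K bK ->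
  (forall (J : finType) (w : J -> 'M[C]_n) (p : J -> R), (forall j, D (w j)) ->
     (forall j, 0 <= p j) -> \sum_j p j = 1 ->
     D (\sum_j real_complex R (p j) *: w j)) ->
  (forall Y0 Y1 (t : R), K Y0 -> K Y1 -> 0 <= t <= 1 ->
     K (real_complex R (1 - t) *: Y0 + real_complex R t *: Y1)) ->
  (forall X, D X -> forall e, 0 < e ->
     exists2 Y, K Y & Rez (\tr (X *m Y)) <= c + e) ->
  forall e, 0 < e ->
    exists2 Y, K Y & forall X, D X -> Rez (\tr (X *m Y)) <= c + e.
Proof.
move=> [Y0 KY0] hD hK convD convK resp e e0.
have [Dn0|D0] := pselect (D !=set0); last first.
  by exists Y0 => // X DX; case: D0; exists X.
(* Changing the real and imaginary parts of [X] by at most [d] changes the pairing by at most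
   [d * M], which is set to [e / 2]; the summand 1 keeps [M] positive. *)
pose M := (n * n)%:R * (2 * `|bK|) + 1 : R.
have M0 : 0 < M by rewrite ltr_wpDl // !mulr_ge0 // ler0n.
pose d := e / 2 / M; have d0 : 0 < d by rewrite !divr_gt0.
have hK' Y : K Y -> forall i j, `|Y i j| <= real_complex R `|bK|.
  by move=> KY i j; rewrite (le_trans (hK _ KY i j)) // lecR ler_norm.
pose x (X : 'M[C]_n) (l : 'I_n * 'I_n * bool) : R :=
  if l.2 then Rez (X l.1.1 l.1.2) else Imz (X l.1.1 l.1.2).
have [|J [w [Dw hw]]] := @bounded_coord_net _ _ x D bD d Dn0 _ d0.
  move=> X [[i j] b] DX; rewrite /x /=.
  by case: b; [apply: Re_norm_le | apply: Im_norm_le]; apply: hD.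
have e20 : 0 < e / 2 by rewrite divr_gt0.
have := @finite_minimax _ J K (fun j Y => Rez (\tr (w j *m Y))) c
  ((n * n)%:R * (2 * bD * `|bK|)).
case/(_ _ _ _ _ (e / 2) e20) => [|Y1 Y2 t KY1 KY2 t01|j Y KY|p p0 p1 s s0|Y KY hY].
- by exists Y0.
- exists (real_complex R (1 - t) *: Y1 + real_complex R t *: Y2); first exact: convK.
  move=> j; rewrite mulmxDr -!scalemxAr mxtraceD !mxtraceZ cReD.
  by rewrite !cReMl.
- apply: Re_tr_mul_le; last exact: hK'.
    by move=> a b; apply/Re_norm_le/hD.
  by move=> a b; apply/Im_norm_le/hD.
- have [Y KY hY] := resp _ (convD _ _ _ Dw p0 p1) _ s0; exists Y => //.
  move: hY; rewrite mulmx_suml mxtrace_sum cRe_sum; congr (_ <= _).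
  by apply: eq_bigr => j _; rewrite -scalemxAl mxtraceZ cReMl.
exists Y => // X DX; have [j hj] := hw _ DX.
have : `|Rez (\tr ((X - w j) *m Y))| <= (n * n)%:R * (2 * d * `|bK|).
  apply: Re_tr_mul_le; last exact: hK'.
    by move=> a b; have := hj (a, b, true); rewrite /x /= entryB cReB.
  move=> a b; have := hj (a, b, false); rewrite /x /= entryB.
  by case: (X a b) (w j a b) => [? ?] [? ?].
move=> /(le_trans (ler_norm _)); rewrite mulmxBl linearB cReB /=.
have : d * M = e / 2 by rewrite /d divfK // gt_eqF.
have := hY j; rewrite /M; set u := (n * n)%:R; set v := `|bK|.
by move=> *; nra.
Qed.

End Minimax.

(** * Channels, the norm of a test operator and its dual *)

Section NormDuality.
Variable R : realType.
Local Notation C := R[i].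
Local Notation Rez := (@complex.Re R).
Local Notation ix i k := (mxtens_index (i, k)).

Lemma psd_tr_real n (X : 'M[C]_n) : psd X -> \tr X = real_complex R (Rez (\tr X)).
Proof. by move=> hX; rewrite RRe_real // ger0_real // psd_tr_ge0. Qed.

Lemma psd_norm_le n (X : 'M[C]_n) i j (b : R) :
  psd X -> Rez (\tr X) <= b -> `|X i j| <= real_complex R b.
Proof.
move=> hX hb; apply: (le_trans (psd_norm_le_tr i j hX)).
by rewrite psd_tr_real // lecR.
Qed.

Lemma le_addMe (x y k : R) : (forall e, 0 < e -> x <= y + e * k) -> x <= y.
Proof.
move=> h; apply/ler_addgt0Pr => e e0.
have k0 : 0 < `|k| + 1 by rewrite ltr_wpDl.
apply: (le_trans (h (e / (`|k| + 1)) _)); first by rewrite divr_gt0.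
rewrite lerD2l mulrAC ler_pdivrMr // ler_pM2l //.
by rewrite (le_trans (ler_norm k)) // lerDl.
Qed.

Lemma affine_comb (V : lmodType C) (r a b : V) (l u v : C) : u + v = 1 ->
  r - l *: (u *: a + v *: b) = u *: (r - l *: a) + v *: (r - l *: b).
Proof.
move=> uv; rewrite !scalerBr addrACA -scalerDl uv scale1r -opprD scalerDr !scalerA.
by rewrite ![l * _]mulrC.
Qed.

Lemma qform_real n (Z : 'M[C]_n) v : adjmx Z = Z -> qform Z v \is Num.real.
Proof.
move=> aZ; apply/CrealP.
have e : adjmx (v *m Z *m adjmx v) = v *m Z *m adjmx v.
  by rewrite !adjmxM adjmxK aZ mulmxA.
by rewrite /qform -{2}e adjmxE.
Qed.

Lemma adjmx_tens m n p q (X : 'M[C]_(m, n)) (Y : 'M[C]_(p, q)) :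
  adjmx (X *t Y) = adjmx X *t adjmx Y.
Proof. by rewrite /adjmx map_mxT trmx_tens. Qed.

Lemma mxtens_index_eq m n i k j l : (ix i k == ix j l :> 'I_(m * n)) = (i == j) && (k == l).
Proof. by rewrite (can_eq (@mxtens_indexK m n)). Qed.

Lemma tensmx11 m n : (1%:M : 'M[C]_m) *t (1%:M : 'M[C]_n) = 1%:M.
Proof.
apply: mxtens_matrixP => i k j l; rewrite tensmxE !mxE mxtens_index_eq.
by case: (i == j); case: (k == l); rewrite ?mulr1 ?mulr0.
Qed.

Lemma psd_tens1 m n (X : 'M[C]_m) : psd X -> psd (X *t (1%:M : 'M[C]_n)).
Proof.
move=> /psd_factor[B ->]; rewrite -[1%:M]mulmx1 -{2}(adjmx1 R n) -tensmx_mul.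
by rewrite -adjmx_tens; apply: psd_gram.
Qed.

Lemma tensmxDl m n p q (X Y : 'M[C]_(m, n)) (Z : 'M[C]_(p, q)) :
  (X + Y) *t Z = X *t Z + Y *t Z.
Proof. by apply/matrixP => i j; rewrite !mxE mulrDl. Qed.

Lemma tensmxZl m n p q a (X : 'M[C]_(m, n)) (Z : 'M[C]_(p, q)) :
  (a *: X) *t Z = a *: (X *t Z).
Proof. by apply/matrixP => i j; rewrite !mxE mulrA. Qed.

Lemma ptrace_tens1 m n (X : 'M[C]_m) : ptrace (X *t (1%:M : 'M[C]_n)) = n%:R *: X.
Proof.
apply/matrixP => i j; rewrite !mxE.
under eq_bigr do rewrite tensmxE mxE eqxx mulr1.
by rewrite sumr_const card_ord mulr_natl.
Qed.

Lemma ptraceD m n (X Y : 'M[C]_(m * n)) : ptrace (X + Y) = ptrace X + ptrace Y.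
Proof.
by apply/matrixP => i j; rewrite !mxE -big_split; apply: eq_bigr => k _; rewrite mxE.
Qed.

Lemma ptraceZ m n a (X : 'M[C]_(m * n)) : ptrace (a *: X) = a *: ptrace X.
Proof.
by apply/matrixP => i j; rewrite !mxE mulr_sumr; apply: eq_bigr => k _; rewrite mxE.
Qed.

Lemma psd_ptrace m n (X : 'M[C]_(m * n)) : psd X -> psd (ptrace X).
Proof.
move=> hX; have -> : ptrace X = \sum_k mxsub (fun i => ix i k) (fun i => ix i k) X.
  by apply/matrixP => i j; rewrite summxE mxE; apply: eq_bigr => k _; rewrite mxE.
by apply: psd_sum => k _; apply: psd_mxsub.
Qed.

Lemma tr_tens1 m n (X : 'M[C]_m) : \tr (X *t (1%:M : 'M[C]_n)) = n%:R * \tr X.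
Proof. by rewrite -tr_ptrace ptrace_tens1 mxtraceZ. Qed.

Lemma tr_mul_tens1 m n (M : 'M[C]_(m * n)) (X : 'M[C]_m) :
  \tr (M *m (X *t 1%:M)) = \tr (ptrace M *m X).
Proof.
rewrite /mxtrace sum_mxtens; apply: eq_bigr => i _.
transitivity (\sum_k \sum_j M (ix i k) (ix j k) * X j i).
  apply: eq_bigr => k _; rewrite mxE sum_mxtens; apply: eq_bigr => j _.
  rewrite (bigD1 k) //= tensmxE !mxE eqxx mulr1 big1 ?addr0 // => l nl.
  by rewrite tensmxE !mxE (negPf nl) !mulr0.
by rewrite exchange_big mxE; apply: eq_bigr => j _; rewrite mxE mulr_suml.
Qed.

(** The missing part [1 - ptrace M] of the marginal is filled in with the maximally mixed output, a
    positive term that can only raise the pairing with a positive [rho]. So [cnorm] also bounds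
    pairings with subnormalised Choi matrices. *)
Lemma channel_extend m n (M : 'M[C]_(m * n)) : (0 < n)%N -> psd M ->
  psd (1%:M - ptrace M) -> exists2 a : lmap R m n, channel a &
    forall rho, psd rho -> Rez (\tr (rho *m M)) <= Rez (pairing rho a).
Proof.
move=> n0 hM hP; pose Q := n%:R^-1 *: ((1%:M - ptrace M) *t (1%:M : 'M[C]_n)).
have hQ : psd Q by apply: psdZ; [rewrite invr_ge0 ler0n | apply: psd_tens1].
exists (chmap (M + Q)).
  split; first by apply: chmap_CP; apply: psdD.
  apply: TP_ptrace; rewrite chmapK ptraceD ptraceZ ptrace_tens1 scalerA mulVf.
    by rewrite scale1r addrC subrK.
  by rewrite pnatr_eq0 -lt0n.
move=> rho hr; rewrite pairingE chmapK mulmxDr mxtraceD cReD lerDl.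
by apply/cRe_ge0/tr_mul_psd_ge0.
Qed.

Lemma channel_ex m n : (0 < n)%N -> exists a : lmap R m n, channel a.
Proof.
move=> n0; have [||a ha _] := @channel_extend m n 0 n0; last by exists a.
  exact: psd0.
have -> : ptrace (0 : 'M[C]_(m * n)) = 0.
  by apply/matrixP => i j; rewrite !mxE big1 // => k _; rewrite mxE.
by rewrite subr0; apply: psd1.
Qed.

Lemma state_ex n : (0 < n)%N -> exists s : 'M[C]_n, state s.
Proof.
move=> n0; exists (n%:R^-1 *: 1%:M); split.
  by apply: psdZ; [rewrite invr_ge0 ler0n | apply: psd1].
by rewrite mxtraceZ mxtrace1 mulVf // pnatr_eq0 -lt0n.
Qed.

Lemma channel_entry_le m n (a : lmap R m n) x y :
  channel a -> `|chmx a x y| <= real_complex R m%:R.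
Proof.
move=> ha; apply: psd_norm_le; first by case: ha => /CP_psd_chmx.
by rewrite chmx_channel_tr // raddfMn.
Qed.

Lemma pairing_le_cnorm m n (rho : 'M[C]_(m * n)) (a : lmap R m n) :
  psd rho -> channel a -> Rez (pairing rho a) <= cnorm rho.
Proof.
move=> hr ha; apply: ub_le_sup; last by exists a.
(* A crude bound suffices: it only makes [sup] a genuine supremum instead of a default value. *)
exists ((m * n * (m * n))%:R * (2 * Rez (\tr rho) * m%:R)) => _ [b hb <-].
rewrite (le_trans (ler_norm _)) // pairingE.
apply: Re_tr_mul_le => *; last exact: channel_entry_le.
  by apply/Re_norm_le/psd_norm_le.
by apply/Im_norm_le/psd_norm_le.
Qed.

Lemma cnorm_le m n (rho : 'M[C]_(m * n)) c : (0 < n)%N ->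
  (forall a : lmap R m n, channel a -> Rez (pairing rho a) <= c) -> cnorm rho <= c.
Proof.
move=> n0 h; have [a ha] := channel_ex m n0.
by apply: ge_sup; [exists (Rez (pairing rho a)), a | move=> _ [b hb <-]; apply: h].
Qed.

Lemma cnorm_ge0 m n (rho : 'M[C]_(m * n)) : (0 < n)%N -> psd rho -> 0 <= cnorm rho.
Proof.
move=> n0 hr; have [a ha] := channel_ex m n0.
apply: le_trans (pairing_le_cnorm hr ha).
by apply/cRe_ge0/pairing_ge0 => //; case: ha.
Qed.

(** [s] projects on a top eigenvector, so [\tr (P *m s)] is the largest eigenvalue of [P]. *)
Lemma psd_top n (P : 'M[C]_n) : (0 < n)%N -> psd P ->
  exists2 s : 'M[C]_n, state s & psd (\tr (P *m s) *: 1%:M - P).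
Proof.
case: n P => // n P _ hP.
have [U [d [UU' U'U eP]]] := hermitian_spectral (psd_adjmx hP).
have [i _ hi] := @Order.TotalTheory.arg_maxP _ _ _ ord0 xpredT (fun i => d 0 i) isT.
exists (adjmx (row i U) *m row i U).
  split; first by rewrite -{2}(adjmxK (row i U)); apply: psd_gram.
  by rewrite -[X in \tr X]mul1mx -qform_tr qform_row mulmx1 UU' mxE eqxx.
rewrite -qform_tr qform_row {1}eP !mulmxA UU' mul1mx -mulmxA UU' mulmx1 diag_mxE mxE.
have -> : real_complex R (d 0 i) *: 1%:M - P = adjmx U *m
   diag_mx (map_mx (real_complex R) (\row_j (d 0 i - d 0 j))) *m adjmx (adjmx U).
  rewrite adjmxK {1}eP.
  have -> : diag_mx (map_mx (real_complex R) (\row_j (d 0 i - d 0 j))) =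
     (real_complex R (d 0 i))%:M - diag_mx (map_mx (real_complex R) d).
    apply/matrixP => j k; rewrite !mxE; have [->|_] := eqVneq j k.
      by rewrite !mulr1n rmorphB.
    by rewrite !mulr0n subrr.
  by rewrite mulmxBr mulmxBl mul_mx_scalar -scalemxAl U'U.
apply/psd_conjugate/psd_qform => v.
rewrite /qform mul_mx_diag mxE; apply: sumr_ge0 => j _.
rewrite adjmxE !mxE mulrAC mulr_ge0 ?mul_conjC_ge0 // ler0c subr_ge0.
exact: hi.
Qed.

Lemma psd_sub_tr n (Y : 'M[C]_n) (e : R) : adjmx Y = Y ->
  (forall X, psd X -> Rez (\tr X) <= 1 -> Rez (\tr (X *m Y)) <= e) ->
  psd (real_complex R e *: 1%:M - Y).
Proof.
move=> aY h; apply: psd_qform => v; rewrite qform_tr.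
set X := adjmx v *m v.
have hX : psd X by rewrite /X -{2}(adjmxK v); apply: psd_gram.
set z := \tr _.
have zr : z \is Num.real.
  rewrite /z -qform_tr; apply: qform_real.
  by rewrite adjmxD adjmxN aY adjmxZ adjmx1; congr (_ *: _ - _); apply: conjc_real.
rewrite -(RRe_real zr) ler0c {zr}/z mulmxBl -scalemxAl mul1mx mxtraceB mxtraceZ.
rewrite cReB cReMl subr_ge0 [\tr (Y *m X)]mxtrace_mulC.
have t0 := cRe_ge0 (psd_tr_ge0 hX).
have [tp|tn] := ltP 0 (Rez (\tr X)); last first.
  have X0 : X = 0.
    apply/matrixP => i j; rewrite [RHS]mxE; apply/eqP; rewrite -normr_le0.
    exact: (psd_norm_le _ _ hX tn).
  by rewrite X0 mul0mx mxtrace0 mulr0.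
have hX' : psd (real_complex R (Rez (\tr X))^-1 *: X).
  by apply: psdZ; rewrite // ler0c invr_ge0.
have := h _ hX'.
rewrite -scalemxAl !mxtraceZ !cReMl mulVf ?gt_eqF // lexx.
by rewrite ler_pdivrMl // [_ * e]mulrC; apply.
Qed.

(* Strong duality, up to [e], for the semidefinite program that defines [cnorm]. *)
Lemma cnorm_dual m n (rho : 'M[C]_(m * n)) (e : R) : (0 < m)%N -> (0 < n)%N ->
  psd rho -> 0 < e -> exists2 s : 'M[C]_m, state s &
  psd ((real_complex R (cnorm rho) *: s + real_complex R e *: 1%:M) *t 1%:M - rho).
Proof.
move=> m0 n0 hr e0; set l := cnorm rho.
have l0 : 0 <= l by apply: cnorm_ge0.
pose Y (s : 'M[C]_m) := rho - real_complex R l *: (s *t (1%:M : 'M[C]_n)).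
pose D := [set X : 'M[C]_(m * n) | psd X /\ Rez (\tr X) <= 1].
pose K := [set Y s | s in @state R m].
have [s0 hs0] := state_ex m0.
(* Here [X] tests the operator inequality [Y s <= 0]; a state that answers every [X] up to [e]
   satisfies [Y s <= e]. The cap on the trace of [X] keeps [D] bounded. *)
have := @matrix_minimax R (m * n) D K 1 (Rez (\tr rho) + l * n%:R) 0.
case/(_ _ _ _ _ _ _ e e0) => [||_ [s [hs ts] <-] i j|J w p hw p0 p1||X [hX tX] d d0|].
- by exists (Y s0), s0.
- by move=> X [hX tX] i j; apply: psd_norm_le.
- have hs1 := psd_tens1 n hs.
  rewrite /Y entryB entryZ (le_trans (ler_normB _ _)) // rmorphD rmorphM lerD //.
    exact: psd_norm_le.
  rewrite normrM ger0_norm ?ler0c // ler_wpM2l ?ler0c //.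
  apply: psd_norm_le => //.
  by rewrite tr_tens1 ts mulr1 raddfMn.
- split.
    by apply: psd_sum => j _; apply: psdZ; [rewrite ler0c | case: (hw j)].
  rewrite mxtrace_sum cRe_sum -[leRHS]p1; apply: ler_sum => j _.
  by rewrite mxtraceZ cReMl ler_piMr //; case: (hw j).
- move=> _ _ t [s [hs ts] <-] [s' [hs' ts'] <-] /andP[t0 t1].
  exists (real_complex R (1 - t) *: s + real_complex R t *: s').
    split; last first.
      by rewrite mxtraceD !mxtraceZ ts ts' !mulr1 -rmorphD subrK.
    by apply: psdD; apply: psdZ; rewrite ?ler0c ?subr_ge0.
  rewrite /Y tensmxDl !tensmxZl; apply: affine_comb.
  by rewrite -rmorphD subrK rmorph1.
(* [X] is answered by a top eigenvector of its marginal, with eigenvalue [t]. As [X / (t + k)] has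
   marginal at most 1, it extends to a channel, so [X] pairs with [rho] to at most [l * (t + k)],
   while the subtracted term is [l * t]. The margin [k] avoids dividing by zero. *)
- have [s hs top] := psd_top m0 (psd_ptrace hX).
  exists (Y s); first by exists s.
  have sr := psd_ptrace hX.
  have t0 : 0 <= \tr (ptrace X *m s) by case: hs => hs _; apply: tr_mul_psd_ge0.
  rewrite add0r /Y mulmxBr -scalemxAr mxtraceB cReB mxtraceZ.
  rewrite cReMl tr_mul_tens1 [\tr (X *m rho)]mxtrace_mulC.
  have tE : \tr (ptrace X *m s) = real_complex R (Rez (\tr (ptrace X *m s))).
    by rewrite RRe_real // ger0_real.
  move: t0 top; rewrite tE ler0c; set t := Rez _ => t0 top.
  rewrite lerBlDr addrC; apply: (@le_addMe _ _ l) => k k0.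
  rewrite -addrA [d + _]addrC addrA; apply: ler_wpDr; first exact: ltW.
  have tk : 0 < t + k by rewrite ltr_wpDl.
  have [||a ha hl] := @channel_extend m n (real_complex R (t + k)^-1 *: X) n0.
  + by apply: psdZ => //; rewrite ler0c invr_ge0 ltW.
  + rewrite ptraceZ.
    have -> : 1%:M - real_complex R (t + k)^-1 *: ptrace X = real_complex R (t + k)^-1
      *: ((real_complex R t *: 1%:M - ptrace X) + real_complex R k *: 1%:M).
      rewrite addrAC -scalerDl -rmorphD scalerBr scalerA -rmorphM mulVf ?gt_eqF //.
      by rewrite scale1r.
    apply: psdZ; first by rewrite ler0c invr_ge0 ltW.
    apply: psdD; first exact: top.
    by apply: psdZ; [rewrite ler0c ltW | apply: psd1].
  have := le_trans (hl _ hr) (pairing_le_cnorm hr ha).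
  rewrite -scalemxAr mxtraceZ cReMl ler_pdivrMl // -/l => h.
  by rewrite [l * t]mulrC -mulrDl.
move=> _ [s hs <-] hY; exists s => //.
have -> : (real_complex R l *: s + real_complex R e *: 1%:M) *t 1%:M - rho
   = real_complex R e *: 1%:M - Y s.
  by rewrite tensmxDl !tensmxZl tensmx11 /Y opprB addrA [_ + real_complex R e *: _]addrC.
apply: psd_sub_tr => [|X hX tX]; last by have := hY X; rewrite add0r; apply.
have as1 : adjmx (s *t (1%:M : 'M[C]_n)) = s *t 1%:M.
  by apply/psd_adjmx/psd_tens1; case: hs.
rewrite /Y adjmxD adjmxN adjmxZ as1 (psd_adjmx hr).
by congr (_ - _ *: _); apply: conjc_real.
Qed.

End NormDuality.

(** * The diamond norm of a difference of channels *)

Section DiamondNorm.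
Variable R : realType.
Local Notation C := R[i].
Local Notation Rez := (@complex.Re R).
Local Notation ix i k := (mxtens_index (i, k)).

Lemma effect_tr_le n (E Y : 'M[C]_n) : effect E -> psd Y ->
  Rez (\tr (E *m Y)) <= Rez (\tr Y).
Proof.
move=> [hE hE'] hY; rewrite -subr_ge0 -cReB.
suff -> : \tr Y - \tr (E *m Y) = \tr ((1%:M - E) *m Y).
  by apply/cRe_ge0/tr_mul_psd_ge0.
by rewrite mulmxBl mul1mx mxtraceB.
Qed.

Section ChannelDifference.
Variables (m n k : nat) (f g : lmap R m n) (rho : 'M[C]_(m * k)).
Hypotheses (hf : channel f) (hg : channel g) (hr : state rho).

Lemma adjmx_tens_id_diff : adjmx (tens_id (f - g) rho) = tens_id (f - g) rho.
Proof.
case: hf hg hr => [cf _] [cg _] [pr _].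
by rewrite tens_idB adjmxD adjmxN !psd_adjmx //; [apply: cg | apply: cf].
Qed.

Lemma tr_tens_id_diff : \tr (tens_id (f - g) rho) = 0.
Proof.
case: hf hg => [_ tf] [_ tg].
by rewrite tens_idB mxtraceB !tr_tens_id // subrr.
Qed.

Lemma pairing_testop_diff (E : 'M[C]_(n * k)) :
  pairing (testop E rho) (f - g) = \tr (E *m tens_id (f - g) rho).
Proof.
case: hf hg => [/CP_psd_chmx cf _] [/CP_psd_chmx cg _].
by rewrite pairingB !tr_testop // tens_idB mulmxBr mxtraceB.
Qed.

End ChannelDifference.

Lemma psd_testop m n k (E : 'M[C]_(n * k)) (rho : 'M[C]_(m * k)) :
  psd E -> psd rho -> psd (testop E rho).
Proof.
move=> hE hr; apply: psd_pairing => h ch.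
rewrite tr_testop; last exact: CP_psd_chmx.
by apply: tr_mul_psd_ge0; [exact: hE | exact: ch].
Qed.

Lemma pairing_testop_le1 m n k (E : 'M[C]_(n * k)) (rho : 'M[C]_(m * k))
    (a : lmap R m n) :
  effect E -> state rho -> channel a -> Rez (pairing (testop E rho) a) <= 1.
Proof.
move=> hE [hr tr1] [ca ta]; rewrite tr_testop; last exact: CP_psd_chmx.
by rewrite (le_trans (effect_tr_le hE (ca _ _ hr))) // tr_tens_id // tr1.
Qed.

(** [w] is constrained channel by channel rather than through [cnorm]. [testop E rho] meets this
    condition because its pairing with a channel is the probability of the effect [E], and the
    condition is visibly convex in [w]. *)
Lemma dnorm_le m n (f g : lmap R m n) (c : R) : (0 < m)%N -> channel f -> channel g ->
  (forall w, psd w -> (forall a : lmap R m n, channel a -> Rez (pairing w a) <= 1) ->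
     Rez (pairing w (f - g)) <= c) ->
  dnorm (f - g) <= 2 * c.
Proof.
move=> m0 hf hg h; apply: ge_sup.
  have [s hs] := @state_ex R (m * m) (eqbRL (muln_gt0 m m) (introT andP (conj m0 m0))).
  by exists (trnorm (tens_id (f - g) s)), s.
move=> _ [rho hr <-].
have [E hE ->] := effect_attains_trnorm (adjmx_tens_id_diff hf hg hr)
  (tr_tens_id_diff rho hf hg).
rewrite ler_pM2l // -pairing_testop_diff //; apply: h => [|a ha].
  by case: hE hr => [pE _] [pr _]; apply: psd_testop.
exact: pairing_testop_le1.
Qed.

Lemma trnorm_le_dnorm m n (f g : lmap R m n) (rho : 'M[C]_(m * m)) :
  channel f -> channel g -> state rho ->
  trnorm (tens_id (f - g) rho) <= dnorm (f - g).
Proof.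
move=> hf hg hr; apply: ub_le_sup; last by exists rho.
exists 2 => _ [s hs <-].
have [E hE ->] := effect_attains_trnorm (adjmx_tens_id_diff hf hg hs)
  (tr_tens_id_diff s hf hg).
rewrite ler_piMr // -pairing_testop_diff // pairingB cReB.
apply: le_trans (pairing_testop_le1 hE hs hf); rewrite gerBl.
case: hE hs hg => [pE _] [ps _] [cg _].
by apply/cRe_ge0/pairing_ge0 => //; apply: psd_testop.
Qed.

Lemma dnorm_sym m n (f g : lmap R m n) : dnorm (f - g) = dnorm (g - f).
Proof.
have h s : trnorm (tens_id (f - g) s) = trnorm (tens_id (g - f) s).
  by rewrite -trnormN !tens_idB opprB.
by rewrite /dnorm (eq_imagel (fun s _ => h m s)).
Qed.

(** The margin [e] keeps the eigenvalues away from 0, so the factor has an inverse, by which a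
    dominated operator can be divided. *)
Lemma posdef_factor n (X : 'M[C]_n) (e : R) : 0 < e ->
  psd (X - real_complex R e *: 1%:M) ->
  exists S S' : 'M[C]_n, X = S *m adjmx S /\ S' *m S = 1%:M.
Proof.
move=> e0 hX.
have pX : psd X.
  rewrite -[X](subrK (real_complex R e *: 1%:M)); apply: psdD; first exact: hX.
  by apply: psdZ; [rewrite ler0c ltW | apply: psd1].
have [U [d [UU' U'U eX]]] := hermitian_spectral (psd_adjmx pX).
have de i : e <= d 0 i.
  have := cRe_ge0 (psd_diag_ge0 i (psd_conjugate U hX)).
  rewrite mulmxBr mulmxBl -scalemxAr mulmx1 -scalemxAl UU' entryB entryZ cReB cReMl.
  rewrite eX !mulmxA UU' mul1mx -mulmxA UU' mulmx1 diag_mxE [1%:M _ _]mxE eqxx /=.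
  by rewrite mulr1 mxE subr_ge0.
pose r i := real_complex R (Num.sqrt (d 0 i)).
have dgt i : 0 < d 0 i by apply: lt_le_trans (de i).
have rn i : r i != 0.
  by rewrite /r fmorph_eq0 sqrtr_eq0 -ltNge.
exists (adjmx U *m diag_mx (\row_i r i)), (diag_mx (\row_i (r i)^-1) *m U); split.
  rewrite adjmxM adjmxK !mulmxA eX; congr (_ *m _); rewrite -mulmxA; congr (_ *m _).
  apply/matrixP => i j; rewrite mul_diag_mx !mxE; have [<-|nij] := eqVneq i j.
    rewrite !mulr1n.
    have -> : (r i)^* = r i by apply: conjc_real.
    by rewrite -rmorphM -expr2 sqr_sqrtr // ltW.
  by rewrite !mulr0n conjC0 mulr0.
rewrite !mulmxA -[_ *m U *m adjmx U]mulmxA UU' mulmx1 mulmx_diag.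
by apply/matrixP => i j; rewrite !mxE mulVf.
Qed.

Lemma tens1_conjugateE m n (S : 'M[C]_m) (G : 'M[C]_(m * n)) i p j q :
  ((S *t (1%:M : 'M[C]_n)) *m G *m adjmx (S *t 1%:M)) (ix i p) (ix j q)
  = \sum_b \sum_a S i a * G (ix a p) (ix b q) * (S j b)^*.
Proof.
rewrite mxE sum_mxtens; apply: eq_bigr => b _.
rewrite (bigD1 q) //= adjmxE tensmxE [1%:M _ _]mxE eqxx mulr1.
rewrite [X in _ + X]big1 => [|c nc]; last first.
  by rewrite adjmxE tensmxE [1%:M _ _]mxE eq_sym (negPf nc) mulr0 conjC0 mulr0.
rewrite addr0 mxE sum_mxtens mulr_suml; apply: eq_bigr => a _.
rewrite (bigD1 p) //= tensmxE [1%:M _ _]mxE eqxx mulr1 big1 ?addr0 // => c nc.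
by rewrite tensmxE [1%:M _ _]mxE eq_sym (negPf nc) mulr0 mul0r.
Qed.

(* Write [rho = (S (x) 1) G (S (x) 1)^*] with [t = S S^*] and [0 <= G <= 1]: then [rho]
   is, up to the factor [tr t], the test operator of a purification of [t / tr t]. *)
Lemma pairing_le_dominated m n (rho : 'M[C]_(m * n)) (t : 'M[C]_m) (e : R)
    (f g : lmap R m n) :
  (0 < m)%N -> channel f -> channel g -> psd rho -> 0 < e ->
  psd (t - real_complex R e *: 1%:M) -> psd (t *t 1%:M - rho) ->
  Rez (pairing rho (f - g)) <= dnorm (f - g) / 2 * Rez (\tr t).
Proof.
move=> m0 hf hg hr e0 ht htr.
have [S [S' [tE S'S]]] := posdef_factor e0 ht.
have SS' : S *m S' = 1%:M by apply: mulmx1C.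
pose Q := S' *t (1%:M : 'M[C]_n); pose G := Q *m rho *m adjmx Q.
have eG : 1%:M - G = Q *m (t *t 1%:M - rho) *m adjmx Q.
  rewrite mulmxBr mulmxBl; congr (_ - _).
  rewrite /Q adjmx_tens adjmx1 !tensmx_mul !mulmx1 tE !mulmxA S'S mul1mx.
  by rewrite -adjmxM S'S adjmx1 tensmx11.
have pG : psd G by apply: psd_conjugate.
have pG' : psd (1%:M - G) by rewrite eG; apply: psd_conjugate.
(* [testop] reads [E] transposed and with its factors swapped; [E] compensates for both. *)
pose s (x : 'I_(n * m)) : 'I_(m * n) :=
  ix (mxtens_unindex x).2 (mxtens_unindex x).1.
pose E := mxsub s s G^T.
have EE q b p a : E (ix q b) (ix p a) = G (ix a p) (ix b q).
  by rewrite !mxE /s !mxtens_indexK.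
have hE : effect E.
  split; first by apply/psd_mxsub/psd_trmx.
  suff -> : 1%:M - E = mxsub s s (1%:M - G)^T by apply/psd_mxsub/psd_trmx.
  apply: mxtens_matrixP => q b p a; rewrite !mxE /s !mxtens_indexK /= !mxtens_index_eq.
  by rewrite andbC [p == q]eq_sym [a == b]eq_sym.
have tt : 0 < Rez (\tr t).
  have := cRe_ge0 (psd_tr_ge0 ht).
  rewrite mxtraceB mxtraceZ mxtrace1 cReB cReMl subr_ge0.
  apply: lt_le_trans; rewrite mulr_gt0 // raddfMn /=.
  by rewrite ltr0n.
(* The vectorisation of [S]: the marginal of [psi *m adjmx psi] on the first factor is
   [S *m adjmx S], that is [t]. *)
pose psi : 'M[C]_(m * m, 1) :=
  \matrix_(x, y) S (mxtens_unindex x).1 (mxtens_unindex x).2.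
have psiE i a j b : (psi *m adjmx psi) (ix i a) (ix j b) = S i a * (S j b)^*.
  by rewrite mxE big_ord1 adjmxE !mxE !mxtens_indexK.
pose s0 := real_complex R (Rez (\tr t))^-1 *: (psi *m adjmx psi).
have ptt : psd t by rewrite tE; apply: psd_gram.
have hs0 : state s0.
  split; first by apply: psdZ; [rewrite ler0c invr_ge0 ltW | apply: psd_gram].
  have -> : \tr s0 = real_complex R (Rez (\tr t))^-1 * \tr t.
    rewrite mxtraceZ; congr (_ * _); rewrite tE /mxtrace sum_mxtens.
    apply: eq_bigr => i _; rewrite [RHS]mxE; apply: eq_bigr => a _.
    by rewrite psiE adjmxE.
  by rewrite [X in _ * X]psd_tr_real // -rmorphM mulVf ?gt_eqF.
have rhoE : rho = real_complex R (Rez (\tr t)) *: testop E s0.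
  have -> : rho = (S *t 1%:M) *m G *m adjmx (S *t 1%:M).
    rewrite /G /Q !mulmxA tensmx_mul SS' mulmx1 tensmx11 mul1mx -mulmxA -adjmxM.
    by rewrite tensmx_mul SS' mulmx1 tensmx11 adjmx1 mulmx1.
  apply: mxtens_matrixP => i p j q; rewrite tens1_conjugateE entryZ testopE.
  rewrite exchange_big mulr_sumr; apply: eq_bigr => a _; rewrite mulr_sumr.
  apply: eq_bigr => b _; rewrite /s0 entryZ psiE EE.
  have k : real_complex R (Rez (\tr t)) * real_complex R (Rez (\tr t))^-1 = 1.
    by rewrite -rmorphM divff ?gt_eqF.
  rewrite [G _ _ * (_ * _)]mulrCA [RHS]mulrA k mul1r mulrA.
  by rewrite [S i a * _]mulrC.
rewrite rhoE pairingE -scalemxAl mxtraceZ cReMl mulrC ler_pM2r //.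
rewrite -pairingE pairing_testop_diff //.
have := effect_le_trnorm (adjmx_tens_id_diff hf hg hs0) (tr_tens_id_diff s0 hf hg) hE.
have := trnorm_le_dnorm hf hg hs0.
by move=> h1 h2; rewrite ler_pdivlMr // mulrC; apply: le_trans h1.
Qed.

(** The slack [e] of [cnorm_dual] does double duty: it also makes the dominating operator positive
    definite, as [pairing_le_dominated] requires. It costs [e * m] in the trace and vanishes in the
    limit. *)
Lemma pairing_le_dnorm m n (rho : 'M[C]_(m * n)) (f g : lmap R m n) :
  (0 < m)%N -> (0 < n)%N -> psd rho -> channel f -> channel g ->
  Rez (pairing rho (f - g)) <= dnorm (f - g) / 2 * cnorm rho.
Proof.
move=> m0 n0 hr hf hg.
apply: (@le_addMe _ _ _ (m%:R * (dnorm (f - g) / 2))) => e e0.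
have [s [ps ts] hs] := cnorm_dual m0 n0 hr e0.
have c0 := cnorm_ge0 n0 hr.
have pl : psd (real_complex R (cnorm rho) *: s) by apply: psdZ; rewrite ?ler0c.
apply: le_trans (pairing_le_dominated m0 hf hg hr e0 _ hs) _.
  by rewrite addrK.
rewrite mxtraceD !mxtraceZ ts mulr1 mxtrace1 cReD cReMl [Rez _%:R]raddfMn /=.
by rewrite le_eqVlt; apply/orP; left; apply/eqP; ring.
Qed.

End DiamondNorm.

(** * Positivity of superchannels and uniform bounds *)

Section Superchannels.
Variable R : realType.
Local Notation C := R[i].
Local Notation Rez := (@complex.Re R).
Local Notation ix i k := (mxtens_index (i, k)).

Lemma blockr_tens_id m n k (f : 'M[C]_m -> 'M[C]_n) (X : 'M[C]_(m * k)) a b :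
  blockr (tens_id f X) a b = f (blockr X a b).
Proof. by apply/matrixP => p q; rewrite mxE tens_idE. Qed.

Lemma CP_psd m n (f : lmap R m n) X : CPmap f -> psd X -> psd (f X).
Proof.
move=> hf hX; pose s (x : 'I_(m * 1)) := (mxtens_unindex x).1.
have h := hf 1%N _ (psd_mxsub s hX).
suff -> : f X = mxsub (fun p => ix p ord0) (fun p => ix p ord0) (tens_id f (mxsub s s X)).
  exact: psd_mxsub.
apply/matrixP => p q; rewrite [RHS]mxE tens_idE; congr (f _ _ _).
by apply/matrixP => i j; rewrite !mxE /s !mxtens_indexK.
Qed.

(** After regrouping the factors, an ancilla [u] on the left and one of size [k] on the right form a
    single ancilla of size [u * k]. *)
Lemma psd_tens_id_id_tens m n u k (f : lmap R m n) (Y : 'M[C]_(u * m * k)) :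
  CPmap f -> psd Y -> psd (tens_id (id_tens f) Y : 'M[C]_(u * n * k)).
Proof.
move=> hf hY.
pose s' (x : 'I_(m * (u * k))) : 'I_(u * m * k) :=
  let: (i, ac) := mxtens_unindex x in let: (a, c) := mxtens_unindex ac in ix (ix a i) c.
pose s (x : 'I_(u * n * k)) : 'I_(n * (u * k)) :=
  let: (ap, c) := mxtens_unindex x in let: (a, p) := mxtens_unindex ap in ix p (ix a c).
suff -> : tens_id (id_tens f) Y = mxsub s s (tens_id f (mxsub s' s' Y)).
  by apply: psd_mxsub; apply: hf; apply: psd_mxsub.
apply: mxtens_matrixP => x c y d.
rewrite -[x]mxtens_unindexK -[y]mxtens_unindexK.
case: (mxtens_unindex x) (mxtens_unindex y) => [a p] [b q].
rewrite tens_idE id_tensE [RHS]mxE /s !mxtens_indexK tens_idE.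
congr (f _ _ _); apply/matrixP => i j.
by rewrite !mxE /s' !mxtens_indexK.
Qed.

Lemma tr_id_tens m n u (f : lmap R m n) (Y : 'M[C]_(u * m)) :
  \tr (id_tens f Y) = \sum_a \tr (f (blockl Y a a)).
Proof.
rewrite /mxtrace sum_mxtens; apply: eq_bigr => a _; apply: eq_bigr => p _.
by rewrite id_tensE.
Qed.

Lemma tr_blockl m u (Y : 'M[C]_(u * m)) : \tr Y = \sum_a \tr (blockl Y a a).
Proof.
rewrite /mxtrace sum_mxtens; apply: eq_bigr => a _; apply: eq_bigr => p _.
by rewrite mxE.
Qed.

Lemma superchannel_CP a0 a1 b0 b1 (L : supch R a0 a1 b0 b1) f :
  is_superchannel L -> CPmap f -> CPmap (L f).
Proof.
move=> [u [pre [post [[cpre _] [cpost _] hL]]]] hf k X hX.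
suff -> : tens_id (L f) X = tens_id post (tens_id (id_tens f) (tens_id pre X)).
  by apply: cpost; apply: psd_tens_id_id_tens => //; apply: cpre.
by apply: mxtens_matrixP => p a q b; rewrite !tens_idE !blockr_tens_id hL.
Qed.

Lemma superchannel_channel a0 a1 b0 b1 (L : supch R a0 a1 b0 b1) f :
  is_superchannel L -> channel f -> channel (L f).
Proof.
move=> sL [cf tf]; split; first exact: superchannel_CP.
case: sL => [u [pre [post [[_ tpre] [_ tpost] hL]]]] X.
rewrite hL tpost tr_id_tens -tpre [RHS]tr_blockl.
by apply: eq_bigr => a _; rewrite tf.
Qed.

Lemma CP_tr_le m n (f : lmap R m n) : CPmap f ->
  exists2 c : R, 0 <= c & forall X, psd X -> \tr (f X) <= real_complex R c * \tr X.
Proof.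
move=> hf; pose c := \sum_i \sum_j `|ptrace (chmx f) i j|.
have c0 : 0 <= c by apply: sumr_ge0 => i _; apply: sumr_ge0.
exists (Rez c); first exact: cRe_ge0.
move=> X hX; rewrite RRe_real ?ger0_real //.
rewrite -[leLHS]ger0_norm; last by apply/psd_tr_ge0/CP_psd.
rewrite tr_lmap (le_trans (ler_norm_sum _ _ _)) // mulr_suml.
apply: ler_sum => i _; rewrite (le_trans (ler_norm_sum _ _ _)) // mulr_suml.
apply: ler_sum => j _; rewrite normrM norm_conjC mulrC ler_wpM2l //.
exact: psd_norm_le_tr.
Qed.

Section Boundedness.
Variables a0 a1 b0 b1 : nat.

(** The bound depends on [f] and [X] only, hence is uniform over ancillas of every dimension. *)
Definition sc_bounded (f : lmap R a0 a1) (X : 'M[C]_b0) := exists B : C,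
  forall L : supch R a0 a1 b0 b1, is_superchannel L -> forall r s, `|L f X r s| <= B.

(** The image is positive, so its trace bounds its entries. Pre- and postprocessing preserve traces,
    and in between each diagonal block over the ancilla gains at most the factor [c] of
    [CP_tr_le]. *)
Lemma sc_bounded_CP f X : CPmap f -> psd X -> sc_bounded f X.
Proof.
move=> hf hX; have [c c0 hc] := CP_tr_le hf.
exists (real_complex R c * \tr X) => L sL r s.
apply: le_trans (psd_norm_le_tr r s (CP_psd (superchannel_CP sL hf) hX)) _.
case: sL => [u [pre [post [[cpre tpre] [_ tpost] hL]]]].
rewrite hL tpost tr_id_tens -tpre tr_blockl mulr_sumr; apply: ler_sum => a _.
apply: hc.
suff -> : blockl (pre X) a a = mxsub (fun i => ix a i) (fun i => ix a i) (pre X).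
  by apply/psd_mxsub/CP_psd.
by apply/matrixP => i j; rewrite !mxE.
Qed.

Lemma sc_boundedD f X Y : sc_bounded f X -> sc_bounded f Y -> sc_bounded f (X + Y).
Proof.
move=> [B hB] [D hD]; exists (B + D) => L sL r s.
by rewrite linearD entryD (le_trans (ler_normD _ _)) // lerD // (hB, hD).
Qed.

Lemma sc_boundedZ f X a : sc_bounded f X -> sc_bounded f (a *: X).
Proof.
move=> [B hB]; exists (`|a| * B) => L sL r s.
by rewrite linearZ entryZ normrM ler_wpM2l // hB.
Qed.

Lemma sc_boundedDl f g X : sc_bounded f X -> sc_bounded g X -> sc_bounded (f + g) X.
Proof.
move=> [B hB] [D hD]; exists (B + D) => L sL r s.
rewrite linearD add_lfunE entryD (le_trans (ler_normD _ _)) //.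
by rewrite lerD // (hB, hD).
Qed.

Lemma sc_boundedZl f X a : sc_bounded f X -> sc_bounded (a *: f) X.
Proof.
move=> [B hB]; exists (`|a| * B) => L sL r s.
by rewrite linearZ scale_lfunE entryZ normrM ler_wpM2l // hB.
Qed.

End Boundedness.

(** The coefficients run over the fourth roots of unity, whose sum and sum of squares both
    vanish. *)
Lemma polarization_sum (V : lmodType C) (W X Z : V) :
  \sum_(b : bool) \sum_(c : bool) (((-1) ^+ b * 'i ^+ c) *: W + X +
     ((-1) ^+ b * 'i ^+ c * ((-1) ^+ b * 'i ^+ c)) *: Z) = X *+ 4.
Proof.
have zz (b c : bool) : (-1) ^+ b * 'i ^+ c * ((-1) ^+ b * 'i ^+ c) = (-1) ^+ c :> C.
  by rewrite mulrACA -!expr2 sqrr_sign mul1r -exprM mulnC exprM sqrCi.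
under eq_bigr => b _ do under eq_bigr => c _ do rewrite zz.
under eq_bigr => b _ do rewrite !big_split /=.
rewrite !big_split /= [X in _ + X]big1 => [|b _]; last first.
  by rewrite big_bool /= expr1 expr0 scaleN1r scale1r addNr.
rewrite addr0 !sumr_const card_bool -mulrnA [X in X + _](_ : _ = 0) ?add0r //.
rewrite exchange_big big1 // => c _; rewrite big_bool /= expr1 expr0.
by rewrite mulN1r mul1r scaleNr addNr.
Qed.

(* Polarization: [X] is the mean of [c (X + c) (X + c)^*] over [c] in {1, -1, i, -i}. *)
Lemma psd_span n (X : 'M[C]_n) : exists A : bool -> bool -> 'M[C]_n,
  (forall b c, psd (A b c)) /\
  X = \sum_(b : bool) \sum_(c : bool) ((-1) ^+ b * 'i ^+ c) *: A b c.
Proof.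
pose A (z : C) := (X + z%:M) *m adjmx (X + z%:M).
have AE z : z * z^* = 1 -> z *: A z =
    z *: (X *m adjmx X + 1%:M) + X + (z * z) *: adjmx X.
  move=> hz; rewrite /A adjmxD mulmxDr !mulmxDl.
  have -> : adjmx (z%:M : 'M[C]_n) = (z^*)%:M.
    apply/matrixP => i j; rewrite adjmxE !mxE eq_sym.
    by case: (i == j); rewrite ?mulr1n ?mulr0n ?conjC0.
  rewrite !mul_mx_scalar !mul_scalar_mx scale_scalar_mx [z^* * z]mulrC hz.
  rewrite !scalerDr !scalerA hz scale1r.
  by rewrite [X + _]addrC addrACA [_ + X]addrC addrA.
exists (fun b c => 4^-1 *: A ((-1) ^+ b * 'i ^+ c)); split.
  by move=> b c; apply: psdZ; [rewrite invr_ge0 ler0n | apply: psd_gram].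
have z1 (b c : bool) : (-1) ^+ b * 'i ^+ c * ((-1) ^+ b * 'i ^+ c)^* = 1 :> C.
  rewrite -normCK normrM normrX normrN1 expr1n mul1r normrX normCi expr1n.
  by rewrite expr1n.
under eq_bigr => b _ do under eq_bigr => c _ do
  rewrite scalerA mulrC -scalerA AE //.
under eq_bigr => b _ do rewrite -scaler_sumr.
rewrite -scaler_sumr polarization_sum.
by rewrite -[X *+ 4]scaler_nat scalerA mulVf ?scale1r // pnatr_eq0.
Qed.

Lemma chmx_inj m n : injective (@chmx R m n).
Proof. by move=> f g e; rewrite -[f]chmxK e chmxK. Qed.

Lemma chmx_sum m n (I : Type) (s : seq I) (P : pred I) (F : I -> lmap R m n) :
  chmx (\sum_(i <- s | P i) F i) = \sum_(i <- s | P i) chmx (F i).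
Proof.
apply: (big_morph (@chmx R m n) (@chmxD R m n)).
by rewrite -[0 in LHS](scale0r 0) chmxZ conjC0 scale0r.
Qed.

(** Polarization of [X] and of the Choi matrix of [f] reduces to [sc_bounded_CP]; the coefficients
    for [f] are conjugated because [chmx] is conjugate-linear. *)
Lemma sc_bounded_all a0 a1 b0 b1 (f : lmap R a0 a1) X : @sc_bounded a0 a1 b0 b1 f X.
Proof.
have [A [hA ->]] := psd_span X; have [B [hB eB]] := psd_span (chmx f).
have -> : f = \sum_(b : bool) \sum_(c : bool)
     (((-1) ^+ b * 'i ^+ c)^* *: chmap (B b c)).
  apply: chmx_inj; rewrite {1}eB chmx_sum; apply: eq_bigr => b _.
  rewrite chmx_sum; apply: eq_bigr => c _.
  by rewrite chmxZ chmapK conjCK.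
rewrite !big_bool /=.
by apply: sc_boundedD; apply: sc_boundedD; apply: sc_boundedZ;
  apply: sc_boundedDl; apply: sc_boundedDl; apply: sc_boundedZl;
  (apply: sc_bounded_CP; [apply: chmap_CP; apply: hB | apply: hA]).
Qed.

End Superchannels.

(** * Sequential compactness for superchannels *)

Section Compactness.
Variable R : realType.
Local Notation C := R[i].
Local Notation Rez := (@complex.Re R).
Local Notation Imz := (@complex.Im R).
Local Notation ix i k := (mxtens_index (i, k)).

Lemma eventually_forall (T : finType) (P : T -> nat -> Prop) :
  (forall t, exists N, forall k, (N <= k)%N -> P t k) ->
  exists N, forall k, (N <= k)%N -> forall t, P t k.
Proof.
move=> /choice[N hN]; exists (\max_t N t) => k hk t.
by apply: hN; apply: leq_trans hk; apply: leq_bigmax.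
Qed.

(** The cluster point is the limit superior, obtained as the supremum of the levels that [u] reaches
    infinitely often. *)
Lemma bounded_seq_cluster (u : nat -> R) (B : R) : (forall k, `|u k| <= B) ->
  exists l, forall e, 0 < e -> forall n, exists2 k, (n <= k)%N & `|u k - l| < e.
Proof.
move=> hB; pose S := [set x | forall n, exists2 k, (n <= k)%N & x <= u k].
have hS : has_sup S.
  split.
    by exists (- B) => n; exists n => //; have := hB n; rewrite ler_norml => /andP[].
  by exists B => x /(_ 0)[k _ /le_trans]; apply; rewrite (le_trans (ler_norm _)).
exists (sup S) => e e0 n.
have [x Sx xl] := sup_adherent e0 hS.
have [N hN] : exists N, forall k, (N <= k)%N -> u k < sup S + e / 2.
  apply: contrapT => /forallNP h.
  have : S (sup S + e / 2).
    move=> N; have /existsNP[k /not_implyP[Nk /negP]] := h N.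
    by rewrite -leNgt => hk; exists k.
  move=> /(ub_le_sup hS.2); rewrite gerDl leNgt => /negP; apply.
  by rewrite divr_gt0.
have [k] := Sx (maxn n N); rewrite geq_max => /andP[nk Nk] xk.
exists k => //; rewrite ltr_norml; apply/andP; split.
  by rewrite ltrBrDr addrC (lt_le_trans xl).
by rewrite ltrBlDl (lt_trans (hN _ Nk)) // ltrD2l ltr_pdivrMr // ltr_pMr // ltr1n.
Qed.

(** Of a subsequence only [n <= h n] is kept: this is stable under composition and enough to
    preserve eventual statements. *)
Lemma bounded_seqs_subseq (T : eqType) (s : seq T) (u : nat -> T -> R) (B : T -> R) :
  (forall k t, `|u k t| <= B t) ->
  exists (h : nat -> nat) (v : T -> R), (forall n, (n <= h n)%N) /\
  forall t, t \in s -> forall e, 0 < e ->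
    exists N, forall k, (N <= k)%N -> `|u (h k) t - v t| < e.
Proof.
move=> hB; elim: s => [|t0 s [h [v [hh hv]]]]; first by exists id, (fun=> 0).
have [l hl] := bounded_seq_cluster (fun k => hB (h k) t0).
have e0 n : 0 < n.+1%:R^-1 :> R by rewrite invr_gt0.
have /choice[g hg] : forall n, exists k, (n <= k)%N /\ `|u (h k) t0 - l| < n.+1%:R^-1.
  by move=> n; have [k nk hk] := hl _ (e0 n) n; exists k.
exists (h \o g), (fun t => if t == t0 then l else v t); split.
  by move=> n /=; apply: leq_trans (hh _); case: (hg n).
move=> t; rewrite inE; case: eqVneq => [-> _|_ /= ts] e egt0; last first.
  have [N hN] := hv _ ts _ egt0; exists N => k Nk /=; apply: hN.
  by apply: leq_trans Nk _; case: (hg k).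
exists (Num.truncn e^-1) => k hk /=; have [_ hgk] := hg k; apply: lt_le_trans hgk _.
rewrite invf_ple ?posrE // ltW //.
apply: lt_le_trans (truncnS_gt _) _.
by rewrite ler_nat ltnS.
Qed.

Lemma norm_le_ReIm (z : C) : `|z| <= real_complex R (`|Rez z| + `|Imz z|).
Proof.
rewrite {1}[z]complexE (le_trans (ler_normD _ _)) // rmorphD lerD //.
  by rewrite normc_def /= expr0n addr0 sqrtr_sqr.
rewrite normrM (_ : `|'i%C| = 1) ?mul1r; last first.
  by rewrite normc_def /= expr0n add0r expr1n sqrtr1.
by rewrite normc_def /= expr0n addr0 sqrtr_sqr.
Qed.

Lemma complex_seqs_subseq (T : finType) (u : nat -> T -> C) :
  (forall t, exists B : C, forall k, `|u k t| <= B) ->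
  exists (h : nat -> nat) (v : T -> C), (forall n, (n <= h n)%N) /\
  forall e, 0 < e -> exists N, forall k, (N <= k)%N ->
    forall t, `|u (h k) t - v t| < real_complex R e.
Proof.
move=> /choice[B hB].
pose w k (x : T * bool) := if x.2 then Rez (u k x.1) else Imz (u k x.1).
have [k [t b]|h [v [hh hv]]] :=
    @bounded_seqs_subseq _ (enum {: T * bool}) w (fun x => Rez (B x.1)).
  have hR : `|u k t| <= real_complex R (Rez (B t)).
    rewrite RRe_real //; have := hB t k; have := normr_ge0 (u k t).
    by move=> h0 /(le_trans h0)/ger0_real.
  by rewrite /w /=; case: b; [apply: Re_norm_le | apply: Im_norm_le].
exists h, (fun t => Complex (v (t, true)) (v (t, false))); split=> // e e0.
have e20 : 0 < e / 2 by rewrite divr_gt0.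
have [N hN] : exists N, forall k, (N <= k)%N -> forall x, `|w (h k) x - v x| < e / 2.
  by apply: eventually_forall => x; apply: hv => //; rewrite mem_enum.
exists N => k Nk t; apply: le_lt_trans (norm_le_ReIm _) _; rewrite ltcR.
have := ltrD (hN _ Nk (t, true)) (hN _ Nk (t, false)); rewrite -splitr /w /=.
by case: (u (h k) t).
Qed.

Section Limit.
Variables a0 a1 b0 b1 : nat.

Definition sc_cvg (L : nat -> supch R a0 a1 b0 b1) (Th : supch R a0 a1 b0 b1) :=
  forall (Phi : lmap R a0 a1) (X : 'M[C]_b0) (i j : 'I_b1) (e : R), 0 < e ->
    exists N : nat, forall k, (N <= k)%N ->
      `|(L k Phi X - Th Phi X) i j| < real_complex R e.

Lemma sc_cvg_pairing L Th f (rho : 'M[C]_(b0 * b1)) (e : R) : sc_cvg L Th -> 0 < e ->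
  exists N, forall k, (N <= k)%N ->
    `|Rez (pairing rho (L k f)) - Rez (pairing rho (Th f))| < e.
Proof.
move=> hL e0.
pose d := \sum_i \sum_j `|rho i j|.
have d0 : 0 <= d by apply: sumr_ge0 => i _; apply: sumr_ge0.
have dE : d = real_complex R (Rez d) by rewrite RRe_real // ger0_real.
have rd i j : `|rho i j| <= real_complex R (Rez d).
  rewrite -dE /d (bigD1 i) //= (bigD1 j) //= -addrA lerDl addr_ge0 ?sumr_ge0 //.
  by move=> k _; apply: sumr_ge0.
pose M := (b0 * b1 * (b0 * b1))%:R * (2 * Rez d) + 1.
have M0 : 0 < M by rewrite ltr_wpDl // !mulr_ge0 ?ler0n // cRe_ge0.
(* The Choi matrix has finitely many entries, read off the images of matrix units, so one [N] serves
   them all. *)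
have [N hN] : exists N, forall k, (N <= k)%N -> forall x : 'I_b0 * 'I_b0 * 'I_b1 * 'I_b1,
    `|(L k f (delta_mx x.1.1.1 x.1.1.2) - Th f (delta_mx x.1.1.1 x.1.1.2)) x.1.2 x.2|
    < real_complex R (e / M).
  by apply: eventually_forall => x; apply: hL; rewrite divr_gt0.
exists N => k Nk; rewrite -cReB -pairingB pairingE.
have : `|Rez (\tr (rho *m chmx (L k f - Th f)))|
    <= (b0 * b1 * (b0 * b1))%:R * (2 * Rez d * (e / M)).
  apply: Re_tr_mul_le => x y; [exact: Re_norm_le | exact: Im_norm_le |].
  rewrite -[x]mxtens_unindexK -[y]mxtens_unindexK.
  case: (mxtens_unindex x) (mxtens_unindex y) => [i p] [j q].
  rewrite chmxE norm_conjC add_lfunE opp_lfunE ltW //.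
  exact: (hN _ Nk (i, j, p, q)).
move/le_lt_trans; apply; rewrite !mulrA ltr_pdivrMr // [ltRHS]mulrC ltr_pM2r //.
by rewrite /M mulrA ltrDl.
Qed.

Lemma lmap_chmap_sum (f : lmap R a0 a1) :
  f = \sum_x \sum_y (chmx f x y)^* *: chmap (delta_mx x y).
Proof.
apply: chmx_inj; rewrite chmx_sum [LHS]matrix_sum_delta; apply: eq_bigr => x _.
rewrite chmx_sum; apply: eq_bigr => y _.
by rewrite chmxZ chmapK conjCK.
Qed.

Lemma supch_chmap_sum (L : supch R a0 a1 b0 b1) f :
  L f = \sum_x \sum_y (chmx f x y)^* *: L (chmap (delta_mx x y)).
Proof.
rewrite {1}[f]lmap_chmap_sum linear_sum; apply: eq_bigr => x _.
by rewrite linear_sum; apply: eq_bigr => y _; rewrite linearZ.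
Qed.

(** [V x y] prescribes the Choi matrix of the image of the basis map [chmap (delta_mx x y)]; the
    conjugate makes the result linear in [f]. *)
Definition sc_of_coords (V : 'I_(a0 * a1) -> 'I_(a0 * a1) -> 'M[C]_(b0 * b1))
  (f : lmap R a0 a1) : lmap R b0 b1 :=
  \sum_x \sum_y (chmx f x y)^* *: chmap (V x y).

Fact sc_of_coords_is_linear V : linear (sc_of_coords V).
Proof.
move=> a f g; rewrite /sc_of_coords scaler_sumr -big_split; apply: eq_bigr => x _.
rewrite scaler_sumr -big_split; apply: eq_bigr => y _.
by rewrite chmxD chmxZ entryD entryZ rmorphD rmorphM /= conjCK scalerDl scalerA.
Qed.

HB.instance Definition _ V := GRing.isLinear.Build C (lmap R a0 a1) (lmap R b0 b1) _
  (sc_of_coords V) (sc_of_coords_is_linear V).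

(** The values on basis maps form finitely many bounded complex sequences; along a common
    subsequence their limits define [Th] by linearity. *)
Lemma superchannel_seq_compact (L : nat -> supch R a0 a1 b0 b1) :
  (forall k, is_superchannel (L k)) ->
  exists (h : nat -> nat) (Th : supch R a0 a1 b0 b1),
    (forall n, (n <= h n)%N) /\ sc_cvg (L \o h) Th.
Proof.
move=> sL.
pose u k (x : 'I_(a0 * a1) * 'I_(a0 * a1) * 'I_(b0 * b1) * 'I_(b0 * b1)) :=
  chmx (L k (chmap (delta_mx x.1.1.1 x.1.1.2))) x.1.2 x.2.
have [[[[x y] z] w]|h [v [hh hv]]] := @complex_seqs_subseq _ u.
  rewrite /u /= -[z]mxtens_unindexK -[w]mxtens_unindexK.
  case: (mxtens_unindex z) (mxtens_unindex w) => [i p] [j q].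
  have [B hB] := @sc_bounded_all R a0 a1 b0 b1 (chmap (delta_mx x y)) (delta_mx i j).
  by exists B => k; rewrite chmxE norm_conjC; apply: hB.
pose V x y : 'M[C]_(b0 * b1) := \matrix_(z, w) v (x, y, z, w).
exists h, (linfun (sc_of_coords V)); split=> // f X r s e e0.
pose M := (\sum_x \sum_y `|chmx f x y|) * (\sum_i \sum_j `|X i j|).
have M0 : 0 <= M.
  by rewrite mulr_ge0 // sumr_ge0 // => i _; rewrite sumr_ge0.
have Mr : M = real_complex R (Rez M) by rewrite RRe_real // ger0_real.
have rM : 0 < Rez M + 1 by rewrite ltr_wpDl // cRe_ge0.
have d0 : 0 < e / (Rez M + 1) by rewrite divr_gt0.
have [N hN] := hv _ d0; exists N => k Nk.
set d := real_complex R (e / (Rez M + 1)) in hN.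
have Df : L (h k) f - linfun (sc_of_coords V) f =
   \sum_x \sum_y (chmx f x y)^* *:
     (L (h k) (chmap (delta_mx x y)) - chmap (V x y)).
  rewrite lfunE /= supch_chmap_sum -sumrB; apply: eq_bigr => x _.
  by rewrite -sumrB; apply: eq_bigr => y _; rewrite scalerBr.
have -> : L (h k) f X - linfun (sc_of_coords V) f X =
    (L (h k) f - linfun (sc_of_coords V) f) X by rewrite add_lfunE opp_lfunE.
rewrite Df sum_lfunE summxE.
apply: (@le_lt_trans _ _ (M * d)); last first.
  rewrite Mr /d -rmorphM ltcR mulrA ltr_pdivrMr // mulrC ltr_pM2l //.
  by rewrite ltrDl.
rewrite (le_trans (ler_norm_sum _ _ _)) // /M -mulrA mulr_suml.
apply: ler_sum => x _; rewrite sum_lfunE summxE (le_trans (ler_norm_sum _ _ _)) //.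
rewrite mulr_suml; apply: ler_sum => y _.
rewrite scale_lfunE entryZ normrM norm_conjC ler_wpM2l //.
rewrite lmapE (le_trans (ler_norm_sum _ _ _)) // mulr_suml; apply: ler_sum => i _.
rewrite (le_trans (ler_norm_sum _ _ _)) // mulr_suml; apply: ler_sum => j _.
rewrite normrM ler_wpM2l // -norm_conjC -chmxE chmxB chmapK entryB.
by have := hN _ Nk (x, y, ix i r, ix j s); rewrite /u /= mxE => /ltW.
Qed.

End Limit.

End Compactness.

(** * Pullback of tests and exchange of quantifiers *)

Section Comparison.
Variable R : realType.
Local Notation C := R[i].
Local Notation Rez := (@complex.Re R).

(** [w] is the image of [rho] under the adjoint of [Th], read off on basis maps; it is positive
    because [Th] preserves complete positivity. *)
Lemma superchannel_pullback a0 a1 r0 r1 (Th : supch R a0 a1 r0 r1)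
    (rho : 'M[C]_(r0 * r1)) :
  is_superchannel Th -> psd rho -> exists2 w : 'M[C]_(a0 * a1), psd w &
    forall f, pairing w f = pairing rho (Th f).
Proof.
move=> sT hr; pose w : 'M[C]_(a0 * a1) :=
  \matrix_(y, x) pairing rho (Th (chmap (delta_mx x y))).
have hw f : pairing w f = pairing rho (Th f).
  transitivity (\sum_y \sum_x w y x * chmx f x y).
    by rewrite pairingE; apply: eq_bigr => y _; rewrite mxE.
  rewrite supch_chmap_sum pairingE.
  rewrite chmx_sum mulmx_sumr mxtrace_sum exchange_big; apply: eq_bigr => x _.
  rewrite chmx_sum mulmx_sumr mxtrace_sum; apply: eq_bigr => y _.
  by rewrite chmxZ conjCK -scalemxAr mxtraceZ mxE pairingE mulrC.
exists w => //; apply: psd_pairing => f cf; rewrite hw.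
by apply: pairing_ge0 => //; apply: superchannel_CP.
Qed.

Lemma superchannel_pairing_le a0 a1 r0 r1 (Th : supch R a0 a1 r0 r1)
    (rho : 'M[C]_(r0 * r1)) (f g : lmap R a0 a1) (e : R) :
  (0 < a0)%N -> (0 < a1)%N -> is_superchannel Th -> psd rho ->
  channel f -> channel g -> 0 <= e -> dnorm (g - f) <= e ->
  Rez (pairing rho (Th f)) <= Rez (pairing rho (Th g)) + e / 2 * cnorm rho.
Proof.
move=> a00 a10 sT hr hf hg e0 hd.
have [w hw wE] := superchannel_pullback sT hr.
have c0 := cnorm_ge0 a10 hw.
(* [Th] maps channels to channels, so every pairing of [w] with a channel is a pairing of [rho] with
   one. *)
have cw : cnorm w <= cnorm rho.
  apply: cnorm_le => // a ha; rewrite wE.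
  by apply: pairing_le_cnorm => //; apply: superchannel_channel.
have := pairing_le_dnorm a00 a10 hw hf hg.
rewrite -!wE pairingB cReB lerBlDl => /le_trans; apply; rewrite lerD2l.
apply: (@le_trans _ _ (e / 2 * cnorm w)); last by rewrite ler_wpM2l // divr_ge0.
apply: ler_wpM2r; first exact: c0.
rewrite ler_pM2r; last by rewrite invr_gt0.
rewrite (dnorm_sym f g); exact: hd.
Qed.

Lemma le_unscale (t x y x' y' q c d : R) : 0 < t -> x' = t^-1 * x -> y' = t^-1 * y ->
  x' <= y' + q * c + d / t -> c <= t^-1 -> 0 <= q -> x <= y + (q + d).
Proof.
move=> tp -> -> h hc q0; have ti : 0 < t^-1 by rewrite invr_gt0.
rewrite -(ler_pM2l ti) !mulrDr addrA; apply: (le_trans h).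
rewrite [t^-1 * d]mulrC lerD2r lerD2l [t^-1 * _]mulrC.
exact: ler_wpM2l.
Qed.

(* The minimax theorem exchanges the quantifiers over test operators and maps. *)
Lemma dnorm_approx m n (S : set (lmap R m n)) (f : lmap R m n) (eps : R) :
  (0 < m)%N -> (0 < n)%N -> S !=set0 -> (forall g, S g -> channel g) ->
  (forall g0 g1 (t : R), S g0 -> S g1 -> 0 <= t <= 1 ->
     S (real_complex R t *: g0 + real_complex R (1 - t) *: g1)) ->
  channel f -> 0 <= eps ->
  (forall rho, state rho -> forall e, 0 < e -> exists2 g, S g &
     Rez (pairing rho f) <= Rez (pairing rho g) + eps / 2 * cnorm rho + e) ->
  forall e, 0 < e -> exists2 g, S g & dnorm (g - f) <= eps + e.
Proof.
move=> m0 n0 [g0 Sg0] chS convS hf eps0 resp e e0.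
pose D := [set w : 'M[C]_(m * n) | psd w /\
  forall a : lmap R m n, channel a -> Rez (pairing w a) <= 1].
pose K := [set chmx (f - g) | g in S].
have e20 : 0 < e / 2 by rewrite divr_gt0.
have nR : 0 < n%:R :> R by rewrite ltr0n.
(* Pairing [w] with the completely depolarising channel bounds its trace by [n]; the Choi matrix of
   a channel has trace [m], whence the bound [m + m] for a difference. *)
have := @matrix_minimax R (m * n) D K n%:R (m%:R + m%:R) (eps / 2).
case/(_ _ _ _ _ _ _ (e / 2) e20).
- by exists (chmx (f - g0)), g0.
- move=> w [hw wa] i j; apply: psd_norm_le => //.
  have [||a ha hl] := @channel_extend R m n (real_complex R n%:R^-1 *: 1%:M) n0.
  + by apply: psdZ; [rewrite ler0c invr_ge0 ltW | apply: psd1].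
  + rewrite ptraceZ -tensmx11 ptrace_tens1 scalerA (_ : _ * _ = 1).
      by rewrite scale1r subrr; apply: psd0.
    by rewrite -(rmorph_nat (real_complex R)) -rmorphM mulVf // gt_eqF.
  have := le_trans (hl _ hw) (wa _ ha).
  by rewrite -scalemxAr mulmx1 mxtraceZ cReMl ler_pdivrMl // mulr1.
- move=> _ [g Sg <-] i j; rewrite chmxB entryB (le_trans (ler_normB _ _)) //.
  by rewrite rmorphD lerD // channel_entry_le //; apply: chS.
- move=> J w p hw p0 p1; split.
    by apply: psd_sum => j _; apply: psdZ; [rewrite ler0c | case: (hw j)].
  move=> a ha; rewrite pairingE mulmx_suml mxtrace_sum cRe_sum -[leRHS]p1.
  apply: ler_sum => j _; rewrite -scalemxAl mxtraceZ cReMl ler_piMr //.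
  by case: (hw j) => _; apply.
- move=> _ _ t [g1 S1 <-] [g2 S2 <-] t01.
  exists (real_complex R (1 - t) *: g1 + real_complex R (1 - (1 - t)) *: g2).
    by apply: convS => //; case/andP: t01 => *; rewrite subr_ge0 gerBl; apply/andP.
  have cr (r : R) : (real_complex R r)^* = real_complex R r by apply: conjc_real.
  rewrite !chmxB chmxD !chmxZ !cr.
  have -> : 1 - (1 - t) = t by rewrite subKr.
  have /(affine_comb (chmx f) (chmx g1) (chmx g2) 1) :
    real_complex R (1 - t) + real_complex R t = 1 by rewrite -rmorphD subrK rmorph1.
  by rewrite !scale1r.
- move=> w [hw wa] d d0; have t0 := cRe_ge0 (psd_tr_ge0 hw).
  have [tp|tn] := ltP 0 (Rez (\tr w)); last first.
    have w0 : w = 0.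
      apply/matrixP => i j; rewrite [RHS]mxE; apply/eqP; rewrite -normr_le0.
      exact: (psd_norm_le _ _ hw tn).
    exists (chmx (f - g0)); first by exists g0.
    by rewrite w0 mul0mx mxtrace0 addr_ge0 // ?divr_ge0 // ltW.
  (* [w] is normalised because the hypothesis speaks of states. Then [cnorm rho <= t^-1], and
     multiplying back by [t] leaves the error [eps / 2 + d]. *)
  set t := Rez (\tr w) in t0 tp.
  pose rho := real_complex R t^-1 *: w.
  have hr : psd rho by apply: psdZ; [rewrite ler0c invr_ge0 | exact: hw].
  have sr : state rho.
    split; first exact: hr.
    by rewrite mxtraceZ (psd_tr_real hw) -/t -rmorphM mulVf ?gt_eqF.
  have pr h : Rez (pairing rho h) = t^-1 * Rez (pairing w h).
    by rewrite !pairingE -scalemxAl mxtraceZ cReMl.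
  have cr : cnorm rho <= t^-1.
    apply: cnorm_le => // a ha; rewrite pr ger_pMr ?invr_gt0 //.
    exact: wa.
  clearbody rho; have dt : 0 < d / t by rewrite divr_gt0.
  have [g Sg hg] := resp rho sr _ dt.
  exists (chmx (f - g)); first by exists g.
  rewrite -pairingE pairingB cReB lerBlDl.
  by apply: (le_unscale tp (pr f) (pr g) hg cr); rewrite divr_ge0.
move=> _ [g Sg <-] hg; exists g; first exact: Sg.
rewrite dnorm_sym.
have -> : eps + e = 2 * (eps / 2 + e / 2) by field.
apply: dnorm_le m0 hf (chS _ Sg) _ => w hw wa.
by apply: hg.
Qed.

End Comparison.

(** * Extended real bounds and the equivalences *)

Lemma deltaF_leP (R : realType) (I : Type) (d0 d1 : I -> nat)
    (F : forall A B : I, set (supch R (d0 A) (d1 A) (d0 B) (d1 B)))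
    (A A' : I) (Phi1 : lmap R (d0 A) (d1 A)) (Phi2 : lmap R (d0 A') (d1 A')) (eps : R) :
  (deltaF F Phi1 Phi2 <= eps%:E)%E <->
  (forall e, 0 < e -> exists2 L, F A A' L & dnorm (L Phi1 - Phi2) <= eps + e).
Proof.
split=> [h e e0|h].
  apply: contrapT => /forall2NP hn.
  have : ((eps + e)%:E <= deltaF F Phi1 Phi2)%E.
    apply: le_ereal_inf_tmp => _ [L FL <-]; rewrite lee_fin leNgt; apply/negP => hl.
    by case: (hn L) => //; rewrite ltW.
  move=> /le_trans /(_ h); rewrite lee_fin gerDl leNgt => /negP.
  by apply.
apply/lee_addgt0Pr => e e0; have [L FL hL] := h _ e0.
by apply: ge_ereal_inf; exists (dnorm (L Phi1 - Phi2))%:E; [exists L | rewrite -EFinD lee_fin].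
Qed.

(** An empty [S] is excluded by the hypothesis, since its supremum is minus infinity. *)
Lemma ereal_sup_response (R : realType) (T : Type) (S : set T) (p : T -> R) (x c e : R) :
  0 < e -> (x%:E <= ereal_sup [set (p L)%:E | L in S] + c%:E)%E ->
  exists2 L, S L & x <= p L + c + e.
Proof.
move=> e0 h; apply: contrapT => /forall2NP hn.
have h5 : (ereal_sup [set (p L)%:E | L in S] <= (x - c - e)%:E)%E.
  apply: ge_ereal_sup => _ [L SL <-]; rewrite lee_fin lerBrDr lerBrDr addrAC leNgt.
  by apply/negP => hl; case: (hn L) => //; rewrite ltW.
have := le_trans h (leeD2r c%:E h5).
by rewrite -EFinD lee_fin => h6; lra.
Qed.

Lemma le_approx (R : realType) (a b z D x q c e : R) :
  a - b <= D / 2 * c -> D <= x + q -> 0 <= c -> q / 2 * c <= e / 2 ->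
  `|b - z| < e / 2 -> a <= z + x / 2 * c + e.
Proof.
move=> h1 h2 c0 h3; rewrite ltr_norml => /andP[_ h4].
have : D / 2 * c <= (x + q) / 2 * c by rewrite ler_wpM2r // ler_pM2r ?invr_gt0.
by rewrite !mulrDl => h5; lra.
Qed.

Theorem theorem3 (R : realType) (I : Type) (d0 d1 : I -> nat)
  (F : forall A B : I, set (supch R (d0 A) (d1 A) (d0 B) (d1 B)))
  (HF : convex_subcategory F)
  (Hdim : forall A : I, (0 < d0 A)%N /\ (0 < d1 A)%N)
  (A A' : I) (Phi1 : lmap R (d0 A) (d1 A)) (Phi2 : lmap R (d0 A') (d1 A')) (eps : R) :
  channel Phi1 -> channel Phi2 -> 0 <= eps ->
  (* (i) <-> (ii) *)
  ((deltaF F Phi1 Phi2 <= eps%:E)%E <->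
     (forall rho : 'M[R[i]]_(d0 A' * d1 A'), state rho ->
        exists2 Th, sc_closure (F A A') Th &
          complex.Re (pairing rho Phi2)
            <= complex.Re (pairing rho (Th Phi1)) + eps / 2 * cnorm rho)) /\
  (* (i) <-> (iii) *)
  ((deltaF F Phi1 Phi2 <= eps%:E)%E <->
     (forall (Rs : I) (rho : 'M[R[i]]_(d0 Rs * d1 Rs)), state rho ->
        (ereal_sup [set (complex.Re (pairing rho (Th Phi2)))%:E | Th in F A' Rs]
         <= ereal_sup [set (complex.Re (pairing rho (Th Phi1)))%:E | Th in F A Rs]
            + (eps / 2 * cnorm rho)%:E)%E)) /\
  (* (i) <-> (iii) restricted to R = A' *)
  ((deltaF F Phi1 Phi2 <= eps%:E)%E <->
     (forall rho : 'M[R[i]]_(d0 A' * d1 A'), state rho ->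
        (ereal_sup [set (complex.Re (pairing rho (Th Phi2)))%:E | Th in F A' A']
         <= ereal_sup [set (complex.Re (pairing rho (Th Phi1)))%:E | Th in F A A']
            + (eps / 2 * cnorm rho)%:E)%E)).
Proof.
move=> h1 h2 eps0; have [Fsc Fconv Fid Fcomp] := HF.
have [m0 n0] := Hdim A'.
have hL L : F A A' L -> channel (L Phi1).
  by move=> /Fsc sL; apply: superchannel_channel.
(* A form of (ii) with slack and without closure, which both (ii) and the restricted (iii) imply. *)
have weak : (forall rho, state rho -> forall e, 0 < e -> exists2 L, F A A' L &
    complex.Re (pairing rho Phi2)
    <= complex.Re (pairing rho (L Phi1)) + eps / 2 * cnorm rho + e) ->
    (deltaF F Phi1 Phi2 <= eps%:E)%E.
  move=> h; apply/deltaF_leP.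
  pose S := [set L Phi1 | L in F A A'].
  (* Any state will do: its response shows that [F A A'] is inhabited. *)
  have [s hs] := state_ex R (eqbRL (muln_gt0 _ _) (introT andP (conj m0 n0))).
  have hS e : 0 < e -> exists2 g, S g & dnorm (g - Phi2) <= eps + e.
    apply: (dnorm_approx m0 n0 _ _ _ h2 eps0).
    - have [L FL _] := h s hs 1 ltr01; by exists (L Phi1), L.
    - by move=> _ [L FL <-]; apply: hL.
    - move=> _ _ t [L FL <-] [L' FL' <-] t01.
      exists (real_complex R t *: L + real_complex R (1 - t) *: L').
        exact: Fconv.
      by rewrite add_lfunE !scale_lfunE.
    - move=> rho hr d d0'; have [L FL hl] := h rho hr d d0'.
      by exists (L Phi1); [exists L | exact: hl].
  by move=> e /hS[_ [L FL <-] hd]; exists L.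
have to_iii : (deltaF F Phi1 Phi2 <= eps%:E)%E ->
    forall (Rs : I) (rho : 'M[R[i]]_(d0 Rs * d1 Rs)), state rho ->
    (ereal_sup [set (complex.Re (pairing rho (Th Phi2)))%:E | Th in F A' Rs]
     <= ereal_sup [set (complex.Re (pairing rho (Th Phi1)))%:E | Th in F A Rs]
       + (eps / 2 * cnorm rho)%:E)%E.
  move=> /deltaF_leP h Rs rho [hr _]; apply: ge_ereal_sup => _ [Th FTh <-].
  have [r0 r1] := Hdim Rs; have c0 := cnorm_ge0 r1 hr.
  set s := ereal_sup _.
  suff hs L : F A A' L -> forall e, 0 < e -> dnorm (L Phi1 - Phi2) <= eps + e ->
      ((complex.Re (pairing rho (Th Phi2)))%:E
       <= s + ((eps + e) / 2 * cnorm rho)%:E)%E.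
    apply/lee_addgt0Pr => e e0.
    have k0 : 0 < cnorm rho + 1 by rewrite ltr_wpDl.
    have e'0 : 0 < e / (cnorm rho + 1) by rewrite divr_gt0.
    have [L FL hd] := h _ e'0; apply: le_trans (hs L FL _ e'0 hd) _.
    rewrite -addeA // -EFinD; apply: leeD2l; rewrite lee_fin.
    rewrite mulrDl mulrDl lerD2l.
    rewrite mulrAC ler_pdivrMr // mulrAC ler_pdivrMr // -mulrA ler_pM2l //.
    by rewrite mulrDr mulr1; nra.
  (* The competitor for [Phi1] is [Th] after the near-optimal [L], which lies in [F A Rs]. *)
  move=> FL e e0 hd.
  have := superchannel_pairing_le m0 n0 (Fsc _ _ _ FTh) hr h2 (hL _ FL)
    (addr_ge0 eps0 (ltW e0)) hd.
  rewrite -lee_fin EFinD => /le_trans; apply; apply: leeD2r.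
  apply: ereal_sup_ubound; exists (Th \o L)%VF; first exact: Fcomp FL FTh.
  by rewrite comp_lfunE.
have from_iii' : (forall rho : 'M[R[i]]_(d0 A' * d1 A'), state rho ->
    (ereal_sup [set (complex.Re (pairing rho (Th Phi2)))%:E | Th in F A' A']
     <= ereal_sup [set (complex.Re (pairing rho (Th Phi1)))%:E | Th in F A A']
       + (eps / 2 * cnorm rho)%:E)%E) -> (deltaF F Phi1 Phi2 <= eps%:E)%E.
  move=> h; apply: weak => rho hr e e0.
  apply: (ereal_sup_response (p := fun L : supch R _ _ _ _ =>
    complex.Re (pairing rho (L Phi1)))) => //; apply: le_trans (h rho hr).
  (* The identity superchannel makes the left supremum at least the pairing with [Phi2]. *)
  by apply: ereal_sup_ubound; exists \1%VF; rewrite ?id_lfunE.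
split; [split|split; split] => //.
- move=> /deltaF_leP h rho [hr _].
  have e0 n : 0 < n.+1%:R^-1 :> R by rewrite invr_gt0.
  have /choice[L hk] : forall n, exists L, F A A' L /\
      dnorm (L Phi1 - Phi2) <= eps + n.+1%:R^-1.
    by move=> n; have [L FL hd] := h _ (e0 n); exists L.
  have [k|g [Th [gn cv]]] := @superchannel_seq_compact R _ _ _ _ L.
    by case: (hk k) => /Fsc.
  exists Th; first by exists (L \o g); split => // k /=; case: (hk (g k)).
  have c0 := cnorm_ge0 n0 hr.
  apply/ler_addgt0Pr => e egt0; have e20 : 0 < e / 2 by rewrite divr_gt0.
  have [N hN] := sc_cvg_pairing Phi1 rho cv e20.
  (* Past [N] the limit is within [e / 2]; past the other bound the tolerance [1 / (k + 1)] costs at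
     most [e / 2]. It is available for [L (g k)] because [k <= g k]. *)
  pose k := maxn N (Num.truncn (cnorm rho / e)).
  have Nk : (N <= k)%N by apply: leq_maxl.
  have hk1 : k.+1%:R^-1 / 2 * cnorm rho <= e / 2.
    rewrite mulrAC ler_pM2r ?invr_gt0 // mulrC ler_pdivrMr ?ltr0n // mulrC.
    rewrite -ler_pdivrMr // ltW //; apply: lt_le_trans (truncnS_gt _) _.
    by rewrite ler_nat ltnS leq_maxr.
  have [FL hd] := hk (g k).
  have hd' : dnorm (L (g k) Phi1 - Phi2) <= eps + k.+1%:R^-1.
    apply: (le_trans hd); rewrite lerD2l lef_pV2 ?posrE ?ltr0n // ler_nat ltnS.
    exact: gn.
  have := pairing_le_dnorm m0 n0 hr h2 (hL _ FL).
  rewrite dnorm_sym pairingB cReB => hp.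
  exact: (le_approx hp hd' c0 hk1 (hN _ Nk)).
- move=> h; apply: weak => rho hr e e0.
  have [Th [L [FL cv]] hT] := h rho hr.
  have [N hN] := sc_cvg_pairing Phi1 rho cv e0.
  exists (L N); first exact: FL.
  have := hN N (leqnn _); rewrite ltr_norml ltrBrDr => /andP[/ltW hl _].
  apply: (le_trans hT); rewrite addrAC lerD2r -lerBlDr addrC.
  exact: hl.
- by move=> h; apply: from_iii' => rho; apply: h.
- by move=> h rho; apply: to_iii.
Qed.
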